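(* Let $\mathbb{T}$ be a bounded time scale, let $t_0,t_1\in\mathbb{T}$ with $t_0<t_1$, and let $\alpha,\beta\in\mathbb{R}$. Write $[t_0,t_1]$ for $[t_0,t_1]\cap\mathbb{T}$. Let $f:[t_0,t_1]^{\kappa}\times\mathbb{R}\times\mathbb{R}\to\mathbb{R}$, $(t,x,r)\mapsto f(t,x,r)$, have continuous partial derivatives $f_x$ and $f_r$ with respect to the second and third variables, respectively, for all $t\in[t_0,t_1]^{\kappa}$, and let $f(\cdot,x,r)$, $f_x(\cdot,x,r)$ and $f_r(\cdot,x,r)$ be continuous. Consider the problem $$\text{minimize}\quad \mathcal{L}[x]=\int_{t_0}^{t_1} f\big(t,x^{\sigma}(t),x^{\Delta}(t)\big)\,\Delta t$$ over all $x\in C^1_{prd}$ satisfying $x(t_0)=\alpha$, $x(t_1)=\beta$. Assume that $$\mu(t) f(t,x,\gamma r_1+(1-\gamma)r_2)\le \mu(t)\gamma f(t,x,r_1)+\mu(t)(1-\gamma)f(t,x,r_2)$$ for each $(t,x)\in[t_0,t_1]^{\kappa}\times\mathbb{R}$, all $r_1,r_2\in\mathbb{R}$ and all $\gamma\in[0,1]$. Let $\bar{x}\in C^1_{prd}$. If $\bar{x}$ is a strong local minimum for this problem, then $$E\big[t,\bar{x}^{\sigma}(t),\bar{x}^{\Delta}(t),q\big]\ge 0$$ for all $t\in[t_0,t_1]^{\kappa}$ and all $q\in\mathbb{R}$, where $$E(t,x,r,q)=f(t,x,q)-f(t,x,r)-(q-r)f_r(t,x,r),$$ and where, at the finitely many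 points $t$ at which $\bar{x}^{\Delta}(t)$ does not exist, $\bar{x}^{\Delta}(t)$ is replaced by $\bar{x}^{\Delta}(t-)$ and by $\bar{x}^{\Delta}(t+)$ (the inequality being asserted for each).
   Context: A time scale is a nonempty closed subset of $\mathbb{R}$, with the topology inherited from $\mathbb{R}$. For a time scale $\mathbb{T}$: $\sigma(t)=\inf\{s\in\mathbb{T}:s>t\}$ and $\rho(t)=\sup\{s\in\mathbb{T}:s<t\}$, with $\inf\emptyset=\sup\mathbb{T}$ and $\sup\emptyset=\inf\mathbb{T}$; the graininess is $\mu(t)=\sigma(t)-t$. A point $t$ is right-scattered if $\sigma(t)>t$, left-scattered if $\rho(t)<t$, right-dense if $t<\sup\mathbb{T}$ and $\sigma(t)=t$, left-dense if $t>\inf\mathbb{T}$ and $\rho(t)=t$. $\mathbb{T}^{\kappa}$ is $\mathbb{T}$ with its left-scattered maximum removed, if it has one (otherwise $\mathbb{T}^\kappa=\mathbb{T}$). The interval $[t_0,t_1]$ means $[t_0,t_1]\cap\mathbb{T}$, and $[t_0,t_1]^{\kappa}$ is formed by the same rule. In the variational problem functions are considered on the time scale $[t_0,t_1]\cap\mathbb{T}$, and the operators $\sigma,\mu,{}^{\Delta}$ are those of this time scale. Write $x^{\sigma}=x\circ\sigma$. A function $g:\mathbb{T}\to\mathbb{R}$ is delta differentiable at $t\in\mathbb{T}^{\kappa}$ with delta derivative $g^{\Delta}(t)$ if for every $\varepsilon>0$ there is $\delta>0$ such that $|g(\sigma(t))-g(s)-g^{\Delta}(t)(\sigma(t)-s)|\le\varepsilon|\sigma(t)-s|$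 for all $s\in(t-\delta,t+\delta)\cap\mathbb{T}$. A function is regulated if finite right-hand limits $g(t+)$ exist at all right-dense points and finite left-hand limits $g(t-)$ exist at all left-dense points. It is rd-continuous ($g\in C_{rd}$) if it is regulated and continuous at all right-dense points. It is piecewise rd-continuous ($g\in C_{prd}$) if it is regulated and rd-continuous at all, except possibly finitely many, right-dense points. $C^1_{prd}$ is the set of continuous functions $g$ for which $g^{\Delta}(t)$ exists for all but possibly finitely many $t\in\mathbb{T}^{\kappa}$ and $g^{\Delta}\in C_{prd}$. The one-sided limits $g^{\Delta}(t-)$ and $g^{\Delta}(t+)$ are considered at left-dense and right-dense points $t$, respectively. For $g\in C_{prd}$ the delta integral is $\int_c^d g(t)\,\Delta t=G(d)-G(c)$, where $G$ is an antiderivative of $g$, i.e. $G$ is continuous and $G^{\Delta}=g$ (except possibly at finitely many right-dense points). A function $x\in C^1_{prd}$ is admissible if $x(t_0)=\alpha$ and $x(t_1)=\beta$. The strong norm is $\|x\|_0=\sup_{t\in[t_0,t_1]^{\kappa}}|x^{\sigma}(t)|$. An admissible $\bar{x}$ is a strong local minimum for the problem if there exists $\delta>0$ such that $\mathcal{L}[\bar{x}]\le\mathcal{L}[x]$ for all admissible $x$ with $\|x-\bar{x}\|_0<\delta$.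
   Formalization: The partial derivatives f_x and f_r are assumed jointly continuous in (t,x,r) on [t_0,t_1]^κ×R×R; with only continuity in (x,r) for each t and in t for each (x,r), the claim fails already on the time scale [0,1]. *)

(* Defs.v *)
From HB Require Import structures.
From mathcomp Require Import all_boot all_order all_algebra.
From mathcomp Require Import all_classical all_reals all_analysis.
Import Order.TTheory GRing.Theory Num.Theory.
Import numFieldNormedType.Exports.
Set Implicit Arguments.
Unset Strict Implicit.
Unset Printing Implicit Defensive.
Local Open Scope classical_set_scope.
Local Open Scope ring_scope.

(* Functions on a time scale T are represented by total functions R -> R;
   every notion below only looks at their values on T.  The real-valued [sup T]
   and [inf T] have their usual meaning because the time scales to which the
   definitions are applied are bounded. *)

Section TimeScale.
Context {R : realType}.
Implicit Types (T : set R) (g G x : R -> R) (t : R).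

Definition time_scale T := closed T /\ T !=set0.

Definition forward_jump T t : R :=
  if `[< exists s, T s /\ t < s >] then inf [set s | T s /\ t < s] else sup T.

Definition backward_jump T t : R :=
  if `[< exists s, T s /\ s < t >] then sup [set s | T s /\ s < t] else inf T.

Definition graininess T t : R := forward_jump T t - t.

Definition left_scattered T t := T t /\ backward_jump T t < t.

Definition right_dense T t := [/\ T t, t < sup T & forward_jump T t = t].

Definition left_dense T t := [/\ T t, inf T < t & backward_jump T t = t].

Definition kappa T : set R :=
  [set t | T t /\ ~ (left_scattered T t /\ (forall s, T s -> s <= t))].

Definition is_delta_derivative T g t (d : R) :=
  forall e : R, 0 < e -> exists2 dlt : R, 0 < dlt &
    forall s, T s -> t - dlt < s < t + dlt ->
      `|g (forward_jump T t) - g s - d * (forward_jump T t - s)|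
        <= e * `|forward_jump T t - s|.

Definition delta_differentiable T g t :=
  exists d, is_delta_derivative T g t d.

(* Unique at the points of [kappa T] where g is delta differentiable; the
   default value 0 is taken where g is not. *)
Definition delta_derivative T g t : R :=
  xget 0 [set d | is_delta_derivative T g t d].

Definition limit_right T g t : R := lim (g @ within T t^'+).
Definition limit_left T g t : R := lim (g @ within T t^'-).

Definition regulated T g :=
  (forall t, right_dense T t -> cvg (g @ within T t^'+)) /\
  (forall t, left_dense T t -> cvg (g @ within T t^'-)).

Definition C_prd T g :=
  regulated T g /\
  finite_set [set t | right_dense T t /\ ~ (g @ within T (nbhs t) --> g t)].

(* The default values of [delta_derivative] at the finitely many points of
   non-differentiability do not affect [C_prd]: the one-sided limits are taken
   over deleted neighbourhoods, and C_prd ignores finitely many points. *)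
Definition C1_prd T g :=
  [/\ {within T, continuous g},
      finite_set [set t | kappa T t /\ ~ delta_differentiable T g t]
    & C_prd T (delta_derivative T g)].

Definition antiderivative T g G :=
  {within T, continuous G} /\
  exists F : set R, [/\ finite_set F, F `<=` right_dense T &
    forall t, kappa T t -> ~ F t -> is_delta_derivative T G t (g t)].

Definition delta_integral T g (c d : R) : R :=
  let G := xget (fun=> 0) [set G | antiderivative T g G] in G d - G c.

Definition strong_norm T x : R :=
  sup [set `|x (forward_jump T t)| | t in kappa T].

End TimeScale.

Section VariationalProblem.
Context {R : realType}.
Implicit Types (I : set R) (f : R -> R -> R -> R) (x xbar : R -> R).

(* The time scale I plays the role of the interval [t0, t1] of a larger time
   scale. *)
Definition functional I f (t0 t1 : R) x : R :=
  delta_integral I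
    (fun t => f t (x (forward_jump I t)) (delta_derivative I x t)) t0 t1.

Definition admissible I (t0 t1 alpha beta : R) x :=
  [/\ C1_prd I x, x t0 = alpha & x t1 = beta].

Definition strong_local_minimum I f (t0 t1 alpha beta : R) xbar :=
  admissible I t0 t1 alpha beta xbar /\
  exists2 dlt : R, 0 < dlt &
    forall x, admissible I t0 t1 alpha beta x ->
      strong_norm I (x \- xbar) < dlt ->
      functional I f t0 t1 xbar <= functional I f t0 t1 x.

Definition partial_x f (t x r : R) : R := derive1 (fun y : R => f t y r) x.
Definition partial_r f (t x r : R) : R := derive1 (fun s : R => f t x s) r.

Definition excess f (t x r q : R) : R :=
  f t x q - f t x r - (q - r) * partial_r f t x r.

End VariationalProblem.

(* Main.v *)
(* At a right-scattered point the convexity hypothesis makes f(t, x, .) convex,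
   so E >= 0 is the tangent inequality.  A left limit at a left-dense point is a
   limit of values of E at earlier points, which leaves a right-dense t with
   p = xbar^Delta(t+).  If right-scattered points accumulate at t from the right,
   pass to the limit again.  Otherwise the time scale contains a real interval
   [t, t + l0], and xbar is perturbed by c = q - p times a tent of slope 1 on
   [t, t + h] and -k on [t + h, t + l], with h small compared to l: the increment
   of the functional divided by h is E(t, xbar(t), p, q) up to small errors.
   All integral estimates come from a mean value inequality, applied to the
   difference of the antiderivatives of the two integrands. *)
Require Import Defs.
From HB Require Import structures.
From mathcomp Require Import all_boot all_order all_algebra.
From mathcomp Require Import all_classical all_reals all_analysis.
From mathcomp Require Import ring lra.
Import Order.TTheory GRing.Theory Num.Theory.
Import numFieldNormedType.Exports.
Local Open Scope classical_set_scope.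
Local Open Scope ring_scope.
Set Implicit Arguments.
Unset Strict Implicit.

(** * Compact time scales and the mean value inequality *)

Section CompactTimeScale.
Context {R : realType}.
Implicit Types (I : set R) (G g : R -> R) (a b c d s t e : R).

(** The strong norm measures the size of x^sigma and ignores slopes, so the slope may change by the
    full amount q - p while the perturbation stays small. Its return to 0 is spread over a longer
    stretch: the slope -c k is then small, but its total effect is not, since k (l - h) = h.
    Expanding f to first order in the slope, the return contributes -c h f_r, which is the linear
    term of E; the displacement itself costs at most C |c| h over a length below l, negligible
    against h once l is small. The integral is the increment of an antiderivative picked by choice,
    with a default value, so nothing is known about the functional until every integrand in play is
    shown to have one. It is obtained from an extremal construction on the time scale itself. A
    left-dense maximum is the delicate point: the antiderivative must be differentiable there with
    the prescribed value, which forces x^Delta at that endpoint to be identified with its left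
    limit. *)

Lemma ler_eps_scaled (x y C : R) :
  (forall e, 0 < e -> x <= y + e * C) -> x <= y.
Proof.
move=> H; apply/ler_addgt0Pr => e e0.
have C0 : 0 < `|C| + 1 by have := normr_ge0 C; lra.
have h := H (e / (`|C| + 1)) (divr_gt0 e0 C0).
apply: (le_trans h); rewrite lerD2l -mulrA ler_piMr//; first exact: ltW.
by rewrite mulrC ler_pdivrMr// mul1r; have := ler_norm C; lra.
Qed.

Lemma closed_approx I c : closed I ->
  (forall e, 0 < e -> exists2 s, I s & `|s - c| < e) -> I c.
Proof.
move=> cI H; apply: cI => B /nbhs_ballP[e /= e0 eB].
have [s Is sc] := H _ e0; exists s; split=> //; apply: eB.
by rewrite /ball /= distrC.
Qed.

Lemma within_continuousP I G : {within I, continuous G} <->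
  forall t, I t -> forall e, 0 < e ->
    exists2 dlt : R, 0 < dlt &
      forall s, I s -> `|s - t| < dlt -> `|G s - G t| < e.
Proof.
rewrite subspace_continuousP; split=> H t It.
  move=> e e0; have /cvgrPdist_lt/(_ e e0)/nbhs_ballP[dl /= d0 dB] := H t It.
  exists dl => // s Is st; rewrite distrC; apply: (dB s) => //.
  by rewrite /ball /= distrC.
apply/cvgrPdist_lt => e e0; have [dl d0 dB] := H t It e e0.
apply/nbhs_ballP; exists dl => //= s; rewrite /ball /= => st Is.
by rewrite distrC; apply: dB => //; rewrite distrC.
Qed.

(** Naming the two extreme points makes [sup I] and [inf I] explicit, and with them the default
    values of the jump operators. *)
Definition compact_time_scale I a b :=
  [/\ closed I, I a, I b & forall s, I s -> a <= s <= b].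

Lemma sup_time_scale I a b : compact_time_scale I a b -> sup I = b.
Proof.
case=> _ _ Ib H; apply/eqP; rewrite eq_le; apply/andP; split.
  by apply: ge_sup; [exists b|move=> s /H/andP[]].
by apply: ub_le_sup => //; exists b => s /H/andP[].
Qed.

Lemma inf_time_scale I a b : compact_time_scale I a b -> inf I = a.
Proof.
case=> _ Ia _ H; apply/eqP; rewrite eq_le; apply/andP; split.
  by apply: ge_inf => //; exists a => s /H/andP[].
by apply: lb_le_inf; [exists a|move=> s /H/andP[]].
Qed.

(** Closedness puts the infimum into I. At t = b the default [sup I] is b itself and the last clause
    is vacuous, so the maximum obeys the same statement. *)
Lemma forward_jumpP I a b t : compact_time_scale I a b -> I t ->
  [/\ I (forward_jump I t), t <= forward_jump I t &
      forall s, I s -> t < s -> forward_jump I t <= s].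
Proof.
move=> ts It; rewrite /forward_jump; case: asboolP => [[u [Iu tu]]|N].
  have hl : has_lbound [set s | I s /\ t < s].
    by exists t => s [_ /ltW].
  have hi : has_inf [set s | I s /\ t < s] by split=> //; exists u.
  have [cI _ _ _] := ts.
  split.
  - apply: closed_approx => // e e0.
    have [s [Is ts'] se] := inf_adherent e0 hi.
    have := ge_inf hl (conj Is ts'); exists s => //.
    by rewrite ger0_norm; lra.
  - by apply: lb_le_inf; [exists u|move=> s [_ /ltW]].
  - by move=> s Is ts'; apply: ge_inf.
rewrite (sup_time_scale ts); have [_ _ Ib /(_ t It)/andP[_ tb]] := ts.
by split=> // s Is ts'; exfalso; apply: N; exists s.
Qed.

Lemma forward_jump_max I a b : compact_time_scale I a b ->
  forward_jump I b = b.
Proof.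
move=> ts; have [_ _ Ib Iab] := ts; have [Is bs _] := forward_jumpP ts Ib.
by apply/eqP; rewrite eq_le bs; have /andP[_ ->] := Iab _ Is.
Qed.

Lemma right_dense_approx I a b t : compact_time_scale I a b ->
  right_dense I t -> forall e, 0 < e -> exists2 s, I s & t < s < t + e.
Proof.
move=> ts [It + tt] e e0; rewrite (sup_time_scale ts) => tb.
have [_ _ Ib _] := ts.
have E : exists s, I s /\ t < s by exists b.
move: tt; rewrite /forward_jump (asboolT E) => tt.
have hi : has_inf [set s | I s /\ t < s] by split=> //; exists t => s [_ /ltW].
have [s [Is ts'] se] := inf_adherent e0 hi.
by exists s => //; rewrite ts' -[ltRHS]/(t + e) -[X in _ < X + e]tt.
Qed.

Lemma left_dense_approx I t : left_dense I t ->
  forall e, 0 < e -> exists2 s, I s & t - e < s < t.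
Proof.
move=> [It at' tt] e e0.
have E : exists s, I s /\ s < t.
  apply: contrapT => N; move: tt; rewrite /backward_jump (asboolF N); lra.
move: tt; rewrite /backward_jump (asboolT E) => tt.
have hs : has_sup [set s | I s /\ s < t] by split=> //; exists t => s [_ /ltW].
have [s [Is ts'] se] := sup_adherent e0 hs.
by exists s => //; rewrite ts' andbT -[X in X - e < _]tt.
Qed.

Lemma right_denseP I a b t : compact_time_scale I a b -> I t -> t < b ->
  right_dense I t \/ t < forward_jump I t.
Proof.
move=> ts It tb; have [_ ts' _] := forward_jumpP ts It.
move: ts'; rewrite le_eqVlt => /orP[/eqP tE|]; last by right.
by left; split=> //; rewrite (sup_time_scale ts).
Qed.

Lemma right_dense_lt I a b t : compact_time_scale I a b ->
  right_dense I t -> t < b.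
Proof. by move=> ts [_]; rewrite (sup_time_scale ts). Qed.

Lemma kappa_lt I a b t : compact_time_scale I a b -> I t -> t < b -> kappa I t.
Proof.
move=> [_ _ Ib _] It tb; split=> // -[_ /(_ _ Ib)]; lra.
Qed.

Lemma kappa_left_dense I t : left_dense I t -> kappa I t.
Proof. by move=> [It _ tE]; split=> // -[[_]]; rewrite tE ltxx. Qed.

Lemma kappa_max_left_dense I a b : compact_time_scale I a b -> a < b ->
  kappa I b -> left_dense I b.
Proof.
move=> ts ab [Ib N]; have [_ Ia _ Iab] := ts.
split=> //; first by rewrite (inf_time_scale ts).
have E : exists s, I s /\ s < b by exists a.
have le : backward_jump I b <= b.
  by rewrite /backward_jump (asboolT E); apply: ge_sup => // s [_ /ltW].
apply/eqP; rewrite eq_le le /= leNgt; apply/negP => lt.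
by apply: N; split=> // s /Iab/andP[].
Qed.

Lemma kappa_cases I a b t : compact_time_scale I a b -> a < b -> kappa I t ->
  [\/ t < forward_jump I t, right_dense I t | t = b /\ left_dense I b].
Proof.
move=> ts ab Kt; have [_ _ _ /(_ t Kt.1)/andP[_]] := ts.
rewrite le_eqVlt => /orP[/eqP tE|tb].
  by subst t; constructor 3; split=> //; exact: (kappa_max_left_dense ts).
by case: (right_denseP ts Kt.1 tb) => ?; [constructor 2|constructor 1].
Qed.

Lemma forward_jump_inside I a b t e : compact_time_scale I a b -> I t ->
  (forall e', 0 < e' -> e' < e -> I (t + e')) -> 0 < e -> forward_jump I t = t.
Proof.
move=> ts It H e0; have [_ tj jl] := forward_jumpP ts It.
apply/eqP; rewrite eq_le tj andbT leNgt; apply/negP => lt.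
set m := Num.min (e / 2) ((forward_jump I t - t) / 2).
have m1 : m <= e / 2 by rewrite ge_min lexx.
have m2 : m <= (forward_jump I t - t) / 2 by rewrite ge_min lexx orbT.
have m0 : 0 < m by rewrite lt_min; apply/andP; split; lra.
have Im : I (t + m) by apply: H; lra.
have := jl _ Im; lra.
Qed.

(** The supremum m of the points up to which P holds lies in I by closedness. P holds at m, by the
    left-dense step if m is not attained, and if m < d the right step goes beyond m. That step
    treats right-scattered and right-dense points together. *)
Lemma time_scale_induction I c d (P : R -> Prop) :
  closed I -> I c -> I d -> c <= d ->
  P c ->
  (forall t, I t -> c <= t < d -> P t ->
     exists s', [/\ I s', t < s' & forall s, I s -> t < s <= s' -> P s]) ->
  (forall t, I t -> c < t <= d ->
     (forall e, 0 < e -> exists2 s, I s & t - e < s < t) ->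
     (forall s, I s -> c <= s < t -> P s) -> P t) ->
  P d.
Proof.
move=> cI Ic Id cd Pc Pright Pleft.
pose S := [set s | [/\ I s, c <= s <= d & forall u, I u -> c <= u <= s -> P u]].
have Sc : S c.
  split=> //; first by rewrite lexx.
  by move=> u _ uc; have -> : u = c by apply/eqP; rewrite eq_le andbC.
have hS : has_sup S by split; [exists c|exists d => s [_ /andP[]]].
set m := sup S.
have cm : c <= m by apply: sup_upper_bound.
have md : m <= d by apply: ge_sup; [exists c|move=> s [_ /andP[]]].
have adh e : 0 < e -> exists2 s, S s & m - e < s <= m.
  move=> e0; have [s Ss se] := sup_adherent e0 hS.
  by exists s => //; rewrite se /=; apply: sup_upper_bound.
have Im : I m.
  apply: closed_approx => // e e0; have [s [Is _ _] /andP[se sm]] := adh _ e0.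
  by exists s => //; rewrite ler0_norm; lra.
have Plt s : I s -> c <= s < m -> P s.
  move=> Is /andP[cs sm].
  have [u [Iu _ Pu] /andP[su _]] := adh (m - s) ltac:(lra).
  by apply: Pu => //; lra.
have Pm : P m.
  have [Sm|nSm] := pselect (S m).
    by have [_ _ Pm] := Sm; apply: Pm => //; rewrite cm lexx.
  have cm' : c < m.
    rewrite lt_neqAle cm andbT; apply/eqP => cE; apply: nSm; by rewrite -cE.
  apply: Pleft => //; first by rewrite cm'.
  move=> e e0; have [s Ss /andP[se sm]] := adh _ e0.
  exists s; first by case: Ss.
  rewrite se lt_neqAle sm andbT; apply/eqP => sE; apply: nSm; by rewrite -sE.
have Pcm s : I s -> c <= s <= m -> P s.
  move=> Is /andP[cs]; rewrite le_eqVlt => /orP[/eqP -> //|sm].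
  by apply: Plt => //; rewrite cs.
have [mE|mNd] := eqVneq m d; first by rewrite -mE.
have md' : m < d by rewrite lt_neqAle mNd.
have [s' [Is' ms' Ps']] := Pright m Im ltac:(by rewrite cm) Pm.
have [s'd|ds'] := leP s' d; last by apply: Ps' => //; rewrite md' ltW.
have Ss' : S s'.
  split=> //; first lra.
  move=> u Iu /andP[cu us']; have [um|mu] := leP u m.
    by apply: Pcm => //; rewrite cu.
  by apply: Ps' => //; rewrite mu.
have : s' <= m by apply: sup_upper_bound.
lra.
Qed.

(** The exceptional points must be right-dense: the increment of G from a right-scattered t to
    [forward_jump I t] is governed by the derivative at t, whereas just after a right-dense point
    continuity makes the increment small. *)
Lemma mean_value_le I a b c d G (M : R) (L : seq R) :
  compact_time_scale I a b -> {within I, continuous G} ->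
  I c -> I d -> c <= d ->
  (forall t, I t -> c <= t < d ->
     (right_dense I t /\ t \in L) \/
     (exists2 k, is_delta_derivative I G t k & k <= M)) ->
  G d - G c <= M * (d - c).
Proof.
move=> ts /within_continuousP cG Ic Id cd H; have [cI _ _ _] := ts.
apply: (@ler_eps_scaled _ _ (d - c + (size L)%:R)) => e e0.
(* [e * N s] pays for the increments of G at the points of L, where only
   continuity is available. *)
pose N s : R := (count (fun x => x < s) L)%:R.
have Nle s t : s <= t -> N s <= N t.
  by move=> st; rewrite ler_nat; apply: sub_count => x /= xs; apply: lt_le_trans st.
(* The count is strict, so moving to the right of a point of L frees a full e at once. *)
have Nlt s t : s \in L -> s < t -> N s + 1 <= N t.
  move=> sL st; rewrite /N natr1 ler_nat.
  have -> : count (fun x : R => (x < t)%R) L =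
      (count (fun x : R => (x < s)%R) L +
       count (fun x : R => ((s <= x) && (x < t))%R) L)%N.
    rewrite -count_predUI [X in (_ + X)%N](_ : _ = 0%N).
      rewrite addn0; apply: eq_count => x /=.
      by case: (ltP x s) => xs //=; rewrite (lt_trans xs).
    by apply/eqP; rewrite -leqn0 leqNgt -has_count; apply/hasPn => x _ /=; case: ltP.
  by rewrite -addn1 leq_add2l -has_count; apply/hasP; exists s; rewrite //= lexx.
suff : G d - G c <= (M + e) * (d - c) + e * N d.
  have : N d <= (size L)%:R by rewrite ler_nat; apply: count_size.
  nra.
apply: (@time_scale_induction I c d
  (fun s => G s - G c <= (M + e) * (s - c) + e * N s)) => //.
- by rewrite !subrr mulr0 add0r mulr_ge0// ltW.
- move=> t It /andP[ct td] Pt; have [Ij tj jl] := forward_jumpP ts It.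
  have near (dl : R) : 0 < dl -> (forall s, I s -> t < s < t + dl ->
      G s - G c <= (M + e) * (s - c) + e * N s) -> right_dense I t ->
      exists s', [/\ I s', t < s' & forall s, I s -> t < s <= s' ->
         G s - G c <= (M + e) * (s - c) + e * N s].
    move=> dl0 Hs /(right_dense_approx ts)/(_ _ dl0)[s' Is' /andP[ts' s'd]].
    exists s'; split=> // s Is /andP[ts1 s1]; apply: Hs => //.
    by rewrite ts1 (le_lt_trans s1).
  have [[rd tL]|[k Gk kM]] := H t It ltac:(by rewrite ct).
    have [dl dl0 Hd] := cG t It (e / 2) ltac:(by lra).
    have M0 := normr_ge0 M.
    (* This keeps |M| (s - t) at most e / 2; the other half of the freed e pays for the oscillation
       of G. *)
    pose dM := e / 2 / (`|M| + 1).
    have dM0 : 0 < dM by apply: divr_gt0; lra.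
    have dME : dM * (`|M| + 1) = e / 2 by rewrite /dM mulfVK//; lra.
    apply: (near (Num.min dl dM)); rewrite ?lt_min ?dl0//.
    move=> s Is /andP[ts1]; rewrite -ltrBlDl lt_min => /andP[sd sM].
    have := Hd s Is ltac:(by rewrite gtr0_norm; lra).
    have := Nlt _ _ tL ts1; rewrite ltr_norml => N1 /andP[_ Gs].
    have M1 : - (`|M| * (s - t)) <= M * (s - t).
      by have : - `|M| <= M by [rewrite lerNl -normrN ler_norm]; nra.
    have M2 : `|M| * (s - t) <= e / 2 by nra.
    nra.
  have [dl dl0 Hd] := Gk e e0.
  case: (right_denseP ts It); first by have [_ _ _ /(_ d Id)] := ts; lra.
    move=> rd; have [_ _ jE] := rd.
    apply: (near dl) => // s Is /andP[ts1 sd].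
    have := Hd s Is ltac:(by lra).
    rewrite jE (@ltr0_norm _ (t - s)) ?subr_lt0// ler_norml.
    have := Nle _ _ (ltW ts1); nra.
  move=> tj'; exists (forward_jump I t); split=> // s Is /andP[ts1 sj].
  have -> : s = forward_jump I t by apply/eqP; rewrite eq_le sj jl.
  (* Testing the delta derivative at s = t itself controls the whole jump. *)
  have := Hd t It ltac:(by lra).
  rewrite (@gtr0_norm _ (_ - t)) ?subr_gt0// ler_norml.
  have := Nle _ _ (ltW tj'); nra.
- move=> t It /andP[ct td] ld Pt.
  (* The bound passes to t by continuity with a fresh e' sent to 0, so left limits spend nothing of
     the budget e. *)
  apply: (@ler_eps_scaled _ _ 1) => e' e'0; rewrite mulr1.
  have [dl dl0 Hd] := cG t It (e' / 2) ltac:(by lra).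
  have M0 := normr_ge0 M.
  pose dM := e' / 2 / (`|M| + 1).
  have dM0 : 0 < dM by apply: divr_gt0; lra.
  have dME : dM * (`|M| + 1) = e' / 2 by rewrite /dM mulfVK//; lra.
  have m0 : 0 < Num.min (Num.min dl dM) (t - c) by rewrite !lt_min dl0 dM0 subr_gt0.
  have [s Is /andP[]] := ld _ m0; rewrite ltrBlDl -ltrBlDr !lt_min => sm st.
  move: sm => /andP[/andP[sd sM] sc].
  have := Pt s Is ltac:(by lra).
  have := Hd s Is ltac:(by rewrite ltr0_norm; lra).
  rewrite ltr_norml => /andP[Gs _].
  have M1 : - (`|M| * (t - s)) <= M * (t - s).
    by have : - `|M| <= M by [rewrite lerNl -normrN ler_norm]; nra.
  have M2 : `|M| * (t - s) <= e' / 2 by nra.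
  have := Nle _ _ (ltW st); nra.
Qed.
End CompactTimeScale.

(** * Existence of antiderivatives, one-sided derivatives *)

Section Antiderivatives.
Context {R : realType}.
Implicit Types (I : set R) (G H g x : R -> R) (a b c d s t e k : R).

Lemma near_right_withinP I t (P : R -> Prop) :
  (\forall s \near within I t^'+, P s) <->
  exists2 e, 0 < e & forall s, I s -> t < s < t + e -> P s.
Proof.
split=> [/nbhs_ballP[e /= e0 eB]|[e e0 eB]].
  exists e => // s Is /andP[ts se]; apply: eB => //.
  by rewrite /ball /= ltr0_norm; lra.
apply/nbhs_ballP; exists e => //= s; rewrite /ball /= => st ts Is.
by apply: eB => //; move: st; rewrite ltr_norml; lra.
Qed.

Lemma near_left_withinP I t (P : R -> Prop) :
  (\forall s \near within I t^'-, P s) <->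
  exists2 e, 0 < e & forall s, I s -> t - e < s < t -> P s.
Proof.
split=> [/nbhs_ballP[e /= e0 eB]|[e e0 eB]].
  exists e => // s Is /andP[ts se]; apply: eB => //.
  by rewrite /ball /= gtr0_norm; lra.
apply/nbhs_ballP; exists e => //= s; rewrite /ball /= => st ts Is.
by apply: eB => //; move: st; rewrite ltr_norml; lra.
Qed.

Lemma near_withinP I t (P : R -> Prop) :
  (\forall s \near within I (nbhs t), P s) <->
  exists2 e, 0 < e & forall s, I s -> `|s - t| < e -> P s.
Proof.
split=> [/nbhs_ballP[e /= e0 eB]|[e e0 eB]].
  by exists e => // s Is st; apply: eB => //; rewrite /ball /= distrC.
apply/nbhs_ballP; exists e => //= s; rewrite /ball /= => st Is.
by apply: eB => //; rewrite distrC.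
Qed.

Lemma approx_left_dense I a b t : compact_time_scale I a b -> I t ->
  (forall e, 0 < e -> exists2 s, I s & t - e < s < t) -> left_dense I t.
Proof.
move=> ts It H; have [s Is /andP[_ st]] := H 1 ltr01.
have [_ _ _ Iab] := ts.
split=> //; first by rewrite (inf_time_scale ts); have := Iab _ Is; lra.
have E : exists s, I s /\ s < t by exists s.
rewrite /backward_jump (asboolT E).
have hs : has_ubound [set s | I s /\ s < t] by exists t => u [_ /ltW].
apply/eqP; rewrite eq_le; apply/andP; split.
  by apply: ge_sup => // u [_ /ltW].
rewrite leNgt; apply/negP => lt.
have [u Iu /andP[u1 u2]] := H _ (ltac:(lra) : 0 < t - sup [set s | I s /\ s < t]).
by have : u <= sup [set s | I s /\ s < t]; [apply: ub_le_sup|lra].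
Qed.

(** Induction along the time scale replaces a compactness argument: a one-sided limit bounds g on
    one side of a dense point, and a right-scattered point adds a single new value. *)
Lemma regulated_bounded I a b g : compact_time_scale I a b -> regulated I g ->
  exists M, forall s, I s -> `|g s| <= M.
Proof.
move=> ts [gr gl]; have [cI Ia Ib Iab] := ts.
have ab : a <= b by have /andP[] := Iab _ Ia.
pose P s := exists M, forall u, I u -> a <= u <= s -> `|g u| <= M.
suff [M HM] : P b.
  by exists M => s Is; apply: HM => //; apply: Iab.
apply: (time_scale_induction (P := P) cI Ia Ib ab).
- by exists `|g a| => u _ ua; rewrite (_ : u = a)//; apply/eqP; rewrite eq_le andbC.
- move=> t It /andP[at' tb] [M HM]; case: (right_denseP ts It tb) => [rd|rs].
    have /cvgrPdist_lt/(_ 1 ltr01)/near_right_withinP[e e0 He] := gr _ rd.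
    set l := lim _ in He.
    have [s' Is' /andP[ts' s'e]] := right_dense_approx ts rd e0.
    exists s'; split=> // s Is /andP[ts1 ss'].
    exists (Num.max M (`|l| + 1)) => u Iu /andP[au us].
    rewrite le_max; have [ut|tu] := leP u t; first by rewrite HM// au.
    apply/orP; right; have := He u Iu ltac:(by rewrite tu (le_lt_trans us)//; lra).
    have := ler_distD l (g u) 0; rewrite !subr0 (distrC (g u)); lra.
  have [Ij tj jl] := forward_jumpP ts It.
  exists (forward_jump I t); split=> // s Is /andP[ts1 ss'].
  exists (Num.max M `|g s|) => u Iu /andP[au us].
  rewrite le_max; have [ut|tu] := leP u t; first by rewrite HM// au.
  by apply/orP; right; rewrite (_ : u = s)//; apply/eqP; rewrite eq_le us
    (le_trans ss')// jl.
- move=> t It /andP[at' tb] /(approx_left_dense ts It) ld Pt.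
  have /cvgrPdist_lt/(_ 1 ltr01)/near_left_withinP[e e0 He] := gl _ ld.
  set l := lim _ in He.
  have [s Is] := left_dense_approx ld (ltac:(by rewrite lt_min e0 subr_gt0) :
    0 < Num.min e (t - a)).
  rewrite ltrBlDr -ltrBlDl lt_min => /andP[/andP[se sa] st].
  have [M HM] := Pt s Is ltac:(by lra).
  exists (Num.max (Num.max M `|g t|) (`|l| + 1)) => u Iu /andP[au].
  rewrite !le_max le_eqVlt => /orP[/eqP ->|ut]; first by rewrite lexx orbT.
  have [us|su] := leP u s; first by rewrite HM// au.
  apply/orP; right; have := He u Iu ltac:(by lra).
  have := ler_distD l (g u) 0; rewrite !subr0 (distrC (g u)); lra.
Qed.

(* The lower Darboux integral, without subdivisions: G is the least function
   vanishing at a whose increment over each [c, d] is at least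
   (d - c) times any lower bound of g on [c, d[. *)
Lemma darboux_antiderivative I a b g (M : R) : compact_time_scale I a b ->
  (forall s, I s -> `|g s| <= M) ->
  exists G, forall c d, I c -> I d -> c <= d -> forall k,
    ((forall s, I s -> c <= s < d -> k <= g s) -> k * (d - c) <= G d - G c) /\
    ((forall s, I s -> c <= s < d -> g s <= k) -> G d - G c <= k * (d - c)).
Proof.
move=> ts gM; have [cI Ia Ib Iab] := ts.
pose dominating H := forall c d, I c -> I d -> c <= d -> forall k,
  (forall s, I s -> c <= s < d -> k <= g s) -> k * (d - c) <= H d - H c.
pose A t := [set H t | H in [set H | dominating H /\ H a = 0]].
pose G t := inf (A t).
have Alb t : I t -> lbound (A t) (- M * (t - a)).
  move=> It _ [H [dH Ha] <-]; rewrite -[leRHS]subr0 -Ha; apply: dH => //.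
    by have /andP[] := Iab _ It.
  by move=> s Is _; have := gM _ Is; rewrite ler_norml => /andP[].
have A0 t : A t !=set0.
  (* The line of slope M dominates, since a lower bound of g on [c, d[ is in particular at most g
     c. *)
  exists (M * (t - a)), (fun t => M * (t - a)) => //; split; last by rewrite subrr mulr0.
  move=> c d Ic Id; rewrite le_eqVlt => /orP[/eqP -> k _|cd k].
    by rewrite !subrr mulr0.
  move=> /(_ c Ic); rewrite lexx cd => /(_ isT) kg.
  have := gM _ Ic; rewrite ler_norml => /andP[_ gcM]; nra.
have Ahl t : I t -> has_lbound (A t) by exists (- M * (t - a)); apply: Alb.
have GH H t : I t -> dominating H -> H a = 0 -> G t <= H t.
  by move=> It dH Ha; apply: ge_inf; [apply: Ahl|exists H].
have dG : dominating G.
  move=> c d Ic Id cd k kg; rewrite lerBrDr; apply: lb_le_inf => // _ [H [dH Ha] <-].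
  have := dH _ _ Ic Id cd _ kg; have := GH _ _ Ic dH Ha; lra.
have Ga : G a = 0.
  rewrite /G (_ : A a = [set 0]) ?inf1//; apply/seteqP; split=> [_ [H [_ Ha] <-]//|_ ->].
  by have [y [H HH Ey]] := A0 a; exists H => //; case: HH.
exists G => c d Ic Id; rewrite le_eqVlt => /orP[/eqP cd k|cd k].
  by rewrite cd !subrr mulr0.
split; first by apply: dG => //; apply: ltW.
move=> gk.
(* Minimality of G yields the upper bound: G is replaced on [c, d] by a line of slope k and shifted
   after d. The result still dominates, because a lower bound m of g on an interval meeting [c, d[
   in a point of I is at most k. *)
pose H s := if s <= c then G s else if s <= d then G c + k * (s - c)
            else G s - G d + G c + k * (d - c).
suff dH : dominating H.
  have := GH H d Id dH; rewrite /H; have /andP[-> _] := Iab _ Ic => /(_ Ga).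
  by rewrite (leNgt d c) cd /= lexx; lra.
move=> u v Iu Iv uv m mg.
have dG' u' v' : I u' -> I v' -> u <= u' -> u' <= v' -> v' <= v ->
    m * (v' - u') <= G v' - G u'.
  move=> Iu' Iv' uu uv' vv; apply: dG => // s Is /andP[s1 s2]; apply: mg => //; lra.
have mk w : I w -> u <= w < v -> c <= w < d -> m <= k.
  by move=> Iw w1 w2; apply: le_trans (mg w Iw w1) (gk w Iw w2).
rewrite /H; case: (leP v c) => vc.
  rewrite (le_trans uv vc); exact: dG'.
case: (leP u c) => uc; case: (leP v d) => vd.
- have := mk c Ic ltac:(by rewrite uc) ltac:(by rewrite lexx).
  have := dG' u c Iu Ic ltac:(by []) uc (ltW vc); nra.
- have := mk c Ic ltac:(by rewrite uc) ltac:(by rewrite lexx).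
  have := dG' u c Iu Ic ltac:(by []) uc (ltW vc).
  have := dG' d v Id Iv (le_trans uc (ltW cd)) (ltW vd) ltac:(by []); nra.
- rewrite (le_trans uv vd); move: uv; rewrite le_eqVlt => /orP[/eqP ->|uv].
    by rewrite !subrr mulr0.
  have := mk u Iu ltac:(by rewrite lexx) ltac:(by rewrite ltW//= (lt_le_trans uv)).
  nra.
- case: (leP u d) => ud; last first.
    have := dG' u v Iu Iv ltac:(by []) uv ltac:(by []); lra.
  have := dG' d v Id Iv ud (ltW vd) ltac:(by []).
  move: ud; rewrite le_eqVlt => /orP[/eqP ->|ud]; first lra.
  have := mk u Iu ltac:(by rewrite lexx (lt_trans ud)) ltac:(by rewrite (ltW uc)).
  nra.
Qed.

(** All points s of I close to a right-scattered t satisfy s <= t, so the allowed error e *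
    (sigma(t) - s) is at least e * (sigma(t) - t) > 0, and continuity at t suffices. *)
Lemma scattered_delta_derivative I a b G t :
  compact_time_scale I a b -> {within I, continuous G} -> I t ->
  t < forward_jump I t ->
  is_delta_derivative I G t
    ((G (forward_jump I t) - G t) / (forward_jump I t - t)).
Proof.
move=> ts /within_continuousP cG It tj e e0; have [Ij _ jl] := forward_jumpP ts It.
set j := forward_jump I t in tj Ij jl *; set q := _ / _.
have m0 : 0 < j - t by rewrite subr_gt0.
have qE : q * (j - t) = G j - G t by rewrite /q mulfVK// gt_eqF.
have q0 := normr_ge0 q.
have [dl dl0 Hd] := cG t It (e * (j - t) / 2) ltac:(by nra).
pose dq := e * (j - t) / 2 / (`|q| + 1).
have dq0 : 0 < dq by apply: divr_gt0; nra.
have dqE : dq * (`|q| + 1) = e * (j - t) / 2 by rewrite /dq mulfVK//; lra.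
exists (Num.min (Num.min dl dq) (j - t)); first by rewrite !lt_min dl0 dq0 m0.
move=> s Is /andP[]; rewrite ltrBlDr -ltrBlDl !lt_min => /andP[/andP[s1 s2] _].
rewrite -ltrBlDl !lt_min => /andP[_ s3].
have st : s <= t by rewrite leNgt; apply/negP => ts'; have := jl _ Is ts'; lra.
have -> : G j - G s - q * (j - s) = (G t - G s) - q * (t - s).
  have : q * (j - s) = q * (j - t) + q * (t - s) by rewrite -mulrDr; congr (_ * _); lra.
  lra.
have := Hd s Is ltac:(by rewrite ler0_norm; lra).
rewrite distrC => Gs.
have qs : `|q| * (t - s) <= e * (j - t) / 2 by nra.
have nB := ler_normB (G t - G s) (q * (t - s)).
rewrite normrM (@ger0_norm _ (t - s)) in nB; last by rewrite subr_ge0.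
rewrite (@gtr0_norm _ (j - s)); nra.
Qed.

(** Points of I arbitrarily close to t and distinct from [forward_jump I t] determine the value. A
    left-scattered maximum has none, which is why [kappa I] removes it. *)
Lemma delta_derivative_unique I a b G t d1 d2 :
  compact_time_scale I a b -> a < b -> kappa I t ->
  is_delta_derivative I G t d1 -> is_delta_derivative I G t d2 -> d1 = d2.
Proof.
move=> ts ab Kt D1 D2; set j := forward_jump I t.
have near e : 0 < e -> exists s, [/\ I s, t - e < s < t + e & s != j].
  move=> e0; case: (kappa_cases ts ab Kt) => [tj|rd|[tE ld]].
  - by exists t; split; [exact: Kt.1|lra|rewrite lt_eqF].
  - have [s Is ss] := right_dense_approx ts rd e0; exists s; split=> //; first lra.
    by rewrite /j; have [_ _ ->] := rd; rewrite gt_eqF//; lra.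
  - have [s Is ss] := left_dense_approx ld e0; exists s; split=> //; first lra.
    by rewrite /j tE (forward_jump_max ts) lt_eqF//; lra.
apply/eqP; rewrite -subr_eq0 -normr_le0; apply: (@ler_eps_scaled _ _ _ 2) => e e0.
have [l1 l10 H1] := D1 e e0; have [l2 l20 H2] := D2 e e0.
have [|s [Is]] := near (Num.min l1 l2); first by rewrite lt_min l10.
have m1 : Num.min l1 l2 <= l1 by rewrite ge_min lexx.
have m2 : Num.min l1 l2 <= l2 by rewrite ge_min lexx orbT.
move=> ss sj; have := H1 s Is ltac:(by lra); have := H2 s Is ltac:(by lra).
rewrite -/j; set A := G j - G s; move=> h2 h1.
have n0 : 0 < `|j - s| by rewrite normr_gt0 subr_eq0 eq_sym.
have := ler_normB (A - d2 * (j - s)) (A - d1 * (j - s)).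
have -> : A - d2 * (j - s) - (A - d1 * (j - s)) = (d1 - d2) * (j - s) by ring.
rewrite normrM add0r => h3; rewrite -(ler_pM2r n0); lra.
Qed.

Lemma delta_derivativeP I G t : delta_differentiable I G t ->
  is_delta_derivative I G t (delta_derivative I G t).
Proof. exact: xgetPex. Qed.

Lemma delta_derivativeE I a b G t d : compact_time_scale I a b -> a < b ->
  kappa I t -> is_delta_derivative I G t d -> delta_derivative I G t = d.
Proof.
move=> ts ab Kt D; apply: (delta_derivative_unique ts ab Kt _ D).
by apply: delta_derivativeP; exists d.
Qed.

Lemma delta_derivativeN I G t d : is_delta_derivative I G t d ->
  is_delta_derivative I (fun s => - G s) t (- d).
Proof.
move=> D e e0; have [l l0 H] := D e e0; exists l => // s Is ss.
by rewrite mulNr -!opprD normrN; apply: H.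
Qed.

Lemma delta_derivativeZ I G t c d : is_delta_derivative I G t d ->
  is_delta_derivative I (fun s => c * G s) t (c * d).
Proof.
move=> D e e0; have c0 := normr_ge0 c; have c1 : 0 < `|c| + 1 by lra.
have [l l0 H] := D _ (divr_gt0 e0 c1); exists l => // s Is ss.
rewrite -mulrA -!mulrBr normrM.
apply: (le_trans (ler_wpM2l c0 (H s Is ss))).
rewrite mulrA ler_wpM2r// mulrCA; apply: ler_piMr; first exact: ltW.
by rewrite ler_pdivrMr//; lra.
Qed.

Lemma delta_derivativeD I G H t d1 d2 : is_delta_derivative I G t d1 ->
  is_delta_derivative I H t d2 ->
  is_delta_derivative I (fun s => G s + H s) t (d1 + d2).
Proof.
move=> D1 D2 e e0; have [l1 l10 H1] := D1 (e / 2) ltac:(by lra).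
have [l2 l20 H2] := D2 (e / 2) ltac:(by lra).
exists (Num.min l1 l2); first by rewrite lt_min l10.
have m1 : Num.min l1 l2 <= l1 by rewrite ge_min lexx.
have m2 : Num.min l1 l2 <= l2 by rewrite ge_min lexx orbT.
move=> s Is ss; have h1 := H1 s Is ltac:(by lra); have h2 := H2 s Is ltac:(by lra).
move: h1 h2; set j := forward_jump I t => h1 h2.
have := ler_normD (G j - G s - d1 * (j - s)) (H j - H s - d2 * (j - s)).
set X := _ + _; rewrite (_ : X = G j + H j - (G s + H s) - (d1 + d2) * (j - s)).
  lra.
by rewrite /X; ring.
Qed.

(* The maximum b belongs to kappa when it is left-dense, but it is not
   right-dense: an antiderivative must have the derivative [g b] there. *)
Lemma antiderivative_exists I a b g : compact_time_scale I a b -> a < b ->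
  C_prd I g -> (left_dense I b -> g @ within I b^'- --> g b) ->
  exists G, antiderivative I g G.
Proof.
move=> ts ab [rg fin] gb; have [M gM] := regulated_bounded ts rg.
have [G HG] := darboux_antiderivative ts gM; exists G.
have cG : {within I, continuous G}.
  apply/within_continuousP => t It e e0.
  have M0 : 0 <= M by apply: le_trans (gM _ It).
  exists (e / (M + 1)); first by apply: divr_gt0; lra.
  move=> s Is; rewrite ltr_pdivlMr ?ltr_wpDl// => st.
  apply: le_lt_trans st; apply: (@le_trans _ _ (M * `|s - t|)); last first.
    by have := normr_ge0 (s - t); nra.
  have lb u : I u -> - M <= g u by move=> /gM; rewrite ler_norml => /andP[].
  have ub u : I u -> g u <= M by move=> /gM; rewrite ler_norml => /andP[].
  case: (leP s t) => st.
    have [/(_ (fun u Iu _ => lb u Iu)) h1 _] := HG s t Is It st (- M).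
    have [_ /(_ (fun u Iu _ => ub u Iu)) h2] := HG s t Is It st M.
    by rewrite (@ler0_norm _ (s - t)) ?subr_le0// ler_norml; nra.
  have [/(_ (fun u Iu _ => lb u Iu)) h1 _] := HG t s It Is (ltW st) (- M).
  have [_ /(_ (fun u Iu _ => ub u Iu)) h2] := HG t s It Is (ltW st) M.
  by rewrite (@gtr0_norm _ (s - t)) ?subr_gt0// ler_norml; nra.
split=> //.
exists [set t | right_dense I t /\ ~ (g @ within I (nbhs t) --> g t)].
split=> //; first by move=> t [].
(* If g stays within e of k, the two Darboux bounds with constants k - e and k + e are exactly a
   derivative estimate. *)
have bound c d k e : I c -> I d -> c <= d ->
    (forall s, I s -> c <= s < d -> `|g s - k| <= e) ->
    `|G d - G c - k * (d - c)| <= e * (d - c).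
  move=> Ic Id cd H; have [h1 _] := HG c d Ic Id cd (k - e).
  have [_ h2] := HG c d Ic Id cd (k + e).
  have {h1} := h1 (fun s Is Hs => ltac:(by have := H s Is Hs; rewrite ler_norml; lra)).
  have {h2} := h2 (fun s Is Hs => ltac:(by have := H s Is Hs; rewrite ler_norml; lra)).
  by rewrite ler_norml; nra.
move=> t Kt nF; have It := Kt.1; case: (kappa_cases ts ab Kt) => [tj|rd|[tE ld]].
- have [Ij _ jl] := forward_jumpP ts It.
  rewrite (_ : g t = (G (forward_jump I t) - G t) / (forward_jump I t - t)).
    exact: (scattered_delta_derivative ts).
  (* Between t and its jump the only sample point is t, so the error is 0 and the increment of G is
     exact. *)
  have := bound t (forward_jump I t) (g t) 0 It Ij (ltW tj).
  have st s : I s -> t <= s < forward_jump I t -> s = t.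
    move=> Is /andP[]; rewrite le_eqVlt => /orP[/eqP //|ts' sj].
    by have := jl _ Is ts'; lra.
  move=> /(_ (fun s Is Hs => ltac:(by rewrite (st s Is Hs) subrr normr0))).
  rewrite mul0r normr_le0 subr_eq0 => /eqP ->; rewrite mulfK// subr_eq0 gt_eqF//.
- have [_ _ jE] := rd; move=> e e0.
  have /cvgrPdist_lt/(_ e e0)/near_withinP[l l0 H] :
    g @ within I (nbhs t) --> g t by apply: contrapT => N; apply: nF.
  exists l => // s Is ss; rewrite jE; have [st|ts'] := leP s t.
    rewrite (@ger0_norm _ (t - s)) ?subr_ge0//; apply: bound => // u Iu /andP[u1 u2].
    by rewrite distrC ltW//; apply: H => //; rewrite ltr_norml; lra.
  rewrite (@ltr0_norm _ (t - s)) ?subr_lt0// (@opprB _ t s) -normrN.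
  rewrite (_ : - (G t - G s - g t * (t - s)) = G s - G t - g t * (s - t)); last by ring.
  apply: bound => //; first exact: ltW.
  move=> u Iu /andP[u1 u2].
  by rewrite distrC ltW//; apply: H => //; rewrite ltr_norml; lra.
- move=> e e0; subst t; have /cvgrPdist_lt/(_ e e0)/near_left_withinP[l l0 H] := gb ld.
  exists l => // s Is ss; rewrite (forward_jump_max ts).
  have [_ _ _ /(_ _ Is)/andP[_ sb]] := ts.
  rewrite (@ger0_norm _ (b - s)) ?subr_ge0//; apply: bound => // u Iu /andP[u1 u2].
  by rewrite distrC ltW//; apply: H => //; lra.
Qed.

Lemma C1_prd_nondifferentiable I a b x t : compact_time_scale I a b -> C1_prd I x ->
  I t -> t < b -> ~ delta_differentiable I x t -> right_dense I t.
Proof.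
move=> ts [cx _ _] It tb nd; case: (right_denseP ts It tb) => // tj.
by case: nd; eexists; apply: (scattered_delta_derivative ts).
Qed.

(** The mean value inequality for x and for -x. A right-dense c may be exempted because a right
    limit of the derivative says nothing about its value at c. *)
Lemma C1_prd_mean_value I a b x c d k e : compact_time_scale I a b -> C1_prd I x ->
  I c -> I d -> c <= d ->
  (forall t, I t -> c <= t < d ->
     (t = c /\ right_dense I c) \/ `|delta_derivative I x t - k| <= e) ->
  `|x d - x c - k * (d - c)| <= e * (d - c).
Proof.
move=> ts C1 Ic Id cd H; have [cx /finite_seqP[L LE] _] := C1.
have cNx : {within I, continuous (fun s => - x s)}.
  move/within_continuousP : cx => cx; apply/within_continuousP => t It e' e'0.
  have [l l0 Hl] := cx t It e' e'0; exists l => // s Is st.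
  by rewrite -opprD normrN; apply: Hl.
have [_ _ _ Iab] := ts; have /andP[_ db] := Iab _ Id.
have key t : I t -> c <= t < d -> (right_dense I t /\ t \in c :: L) \/
    [/\ is_delta_derivative I x t (delta_derivative I x t) &
        `|delta_derivative I x t - k| <= e].
  move=> It /andP[ct td].
  have [Dt|nD] := pselect (delta_differentiable I x t); last first.
    left; have tb := lt_le_trans td db.
    split; first exact: (C1_prd_nondifferentiable ts C1).
    rewrite inE; apply/orP; right.
    have : [set t | kappa I t /\ ~ delta_differentiable I x t] t.
      by split=> //; apply: (kappa_lt ts).
    by rewrite LE.
  case: (H t It ltac:(by rewrite ct)) => [[tE rd]|xk]; [left|right].
    by rewrite tE; split=> //; rewrite inE eqxx.
  by split=> //; apply: delta_derivativeP.
have h1 : x d - x c <= (k + e) * (d - c).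
  apply: (mean_value_le ts cx Ic Id cd (L := c :: L)) => t It Ht.
  case: (key t It Ht) => [?|[D]]; first by left.
  by rewrite ler_norml => Dk; right; eexists; [exact: D|lra].
have h2 : - x d - - x c <= (e - k) * (d - c).
  apply: (mean_value_le ts cNx Ic Id cd (L := c :: L)) => t It Ht.
  case: (key t It Ht) => [?|[D]]; first by left.
  by rewrite ler_norml => Dk; right; eexists; [exact: delta_derivativeN D|lra].
by rewrite ler_norml; lra.
Qed.

(** A derivative has no jump at a point where it exists: by the mean value estimate, the difference
    quotients to the right of t tend to l. *)
Lemma C1_prd_right_derivative I a b x t (l d : R) : compact_time_scale I a b ->
  C1_prd I x -> right_dense I t ->
  delta_derivative I x @ within I t^'+ --> l ->
  is_delta_derivative I x t d -> d = l.
Proof.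
move=> ts C1 rd /cvgrPdist_lt xl D; have [It _ jE] := rd.
apply/eqP; rewrite -subr_eq0 -normr_le0; apply: (@ler_eps_scaled _ _ _ 2) => e e0.
have [l1 l10 H1] := D e e0.
have /near_right_withinP[l2 l20 H2] := xl e e0.
have [|s Is] := right_dense_approx ts rd (e := Num.min l1 l2).
  by rewrite lt_min l10.
have m1 : Num.min l1 l2 <= l1 by rewrite ge_min lexx.
have m2 : Num.min l1 l2 <= l2 by rewrite ge_min lexx orbT.
move=> /andP[ts' s2].
have h1 := H1 s Is ltac:(by lra).
have h2 : `|x s - x t - l * (s - t)| <= e * (s - t).
  apply: (C1_prd_mean_value ts C1) => //; first exact: ltW.
  move=> u Iu /andP[]; rewrite le_eqVlt => /orP[/eqP <-|tu us]; first by left.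
  by right; rewrite distrC ltW//; apply: H2 => //; lra.
rewrite jE (@ltr0_norm _ (t - s)) ?subr_lt0// opprB in h1.
have := ler_normD (x t - x s - d * (t - s)) (x s - x t - l * (s - t)).
rewrite (_ : _ + _ = (d - l) * (s - t)); last by ring.
rewrite normrM (@gtr0_norm _ (s - t)) ?subr_gt0// add0r => h3.
by rewrite -(@ler_pM2r _ (s - t)) ?subr_gt0//; lra.
Qed.

(** This identifies the derivative at b, so that an integrand built from it meets the
    left-continuity condition of [antiderivative_exists]. *)
Lemma C1_prd_left_derivative_max I a b x (l : R) : compact_time_scale I a b ->
  C1_prd I x -> delta_derivative I x @ within I b^'- --> l ->
  is_delta_derivative I x b l.
Proof.
move=> ts C1 /cvgrPdist_lt xl e e0.
have /near_left_withinP[l2 l20 H2] := xl e e0.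
have [_ _ Ib Iab] := ts.
exists l2 => // s Is ss; rewrite (forward_jump_max ts).
have /andP[_ sb] := Iab _ Is.
rewrite (@ger0_norm _ (b - s)) ?subr_ge0//.
apply: (C1_prd_mean_value ts C1) => // u Iu /andP[su ub].
by right; rewrite distrC ltW//; apply: H2 => //; lra.
Qed.

End Antiderivatives.

(** * Continuity of the integrand and of the excess function *)

Section Integrands.
Context {R : realType}.
Implicit Types (I K : set R) (F f : R -> R -> R -> R) (g h x : R -> R)
  (a b s t r y z k e l q : R).

Definition jointly_continuous_on K F := forall t y r, K t -> forall e, 0 < e ->
  exists2 l, 0 < l & forall s y' r', K s -> `|s - t| < l -> `|y' - y| < l ->
    `|r' - r| < l -> `|F s y' r' - F t y r| < e.

Lemma within_jointly_continuous K F :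
  {within [set p : R * R * R | K p.1.1],
    continuous (fun p : R * R * R => F p.1.1 p.1.2 p.2)} ->
  jointly_continuous_on K F.
Proof.
move=> /subspace_continuousP H t y r Kt e e0.
have /cvgrPdist_lt/(_ e e0)/nbhs_ballP[l /= l0 lB] := H (t, y, r) Kt.
exists l => // s y' r' Ks st yy rr; rewrite distrC.
apply: (lB (s, y', r')) => //; split; first split; by rewrite /ball /= distrC.
Qed.

(** With k = 0 this serves as a Lipschitz bound, with k a nearby slope as a first-order
    expansion. *)
Lemma linear_approximation g k e u v :
  (forall z, derivable g z 1) ->
  (forall z, u <= z <= v \/ v <= z <= u -> `|derive1 g z - k| <= e) ->
  `|g v - g u - k * (v - u)| <= e * `|v - u|.
Proof.
move=> dg; wlog uv : u v / u <= v => [th|] He.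
  have [/th|/ltW vu] := leP u v; first exact.
  rewrite -normrN (distrC v)
    (_ : - (g v - g u - k * (v - u)) = g u - g v - k * (u - v)); last by ring.
  by apply: th => // z Hz; apply: He; case: Hz; [right|left].
have [c] : exists2 c, c \in `[u, v]%R & g v - g u = derive1 g c * (v - u).
  apply: MVT_segment => //.
    by move=> z _; apply: DeriveDef => //; rewrite derive1E.
  apply: continuous_subspaceT => z.
  exact/differentiable_continuous/derivable1_diffP.
rewrite in_itv /= => cuv ->.
rewrite -mulrBl normrM ler_wpM2r//; apply: He; by left.
Qed.

(** Joint continuity bounds both partial derivatives near the point, so f is Lipschitz in (y, r)
    uniformly in time there; continuity in t at the fixed pair (y, r) then completes the
    estimate. *)
Lemma jointly_continuous_of_partials K f :
  (forall t y r, K t -> derivable (fun y => f t y r) y 1) ->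
  (forall t y r, K t -> derivable (fun r => f t y r) r 1) ->
  jointly_continuous_on K (partial_x f) ->
  jointly_continuous_on K (partial_r f) ->
  (forall y r, {within K, continuous (fun t => f t y r)}) ->
  jointly_continuous_on K f.
Proof.
move=> dx dr jx jr cf t y r Kt e e0.
have [l1 l10 H1] := jx t y r Kt 1 ltr01.
have [l2 l20 H2] := jr t y r Kt 1 ltr01.
have /within_continuousP/(_ t Kt (e / 3) ltac:(by lra))[l3 l30 H3] := cf y r.
set A := partial_x f t y r in H1; set B := partial_r f t y r in H2.
pose C := `|A| + `|B| + 1.
have C0 : 0 < C by rewrite /C; have := normr_ge0 A; have := normr_ge0 B; lra.
pose l4 := e / 3 / C.
have l40 : 0 < l4 by rewrite divr_gt0//; lra.
have l4E : l4 * C = e / 3 by rewrite /l4 mulfVK// gt_eqF.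
exists (Num.min (Num.min l1 l2) (Num.min l3 l4)); first by rewrite !lt_min l10 l20 l30.
move=> s y' r' Ks; rewrite !lt_min => /andP[/andP[s1 s2] /andP[s3 _]].
move=> /andP[/andP[y1 y2] /andP[_ y4]] /andP[/andP[r1 r2] /andP[_ r4]].
have hy : `|f s y' r' - f s y r' - 0 * (y' - y)| <= C * `|y' - y|.
  apply: (@linear_approximation (fun y => f s y r')) => [z|z Hz]; first exact: dx.
  have := H1 s z r' Ks s1 ltac:(by move: y1; rewrite !ltr_norml; lra) r1.
  have := ler_distD A (partial_x f s z r') 0; rewrite /C !subr0.
  have := normr_ge0 B; rewrite /partial_x; clear; lra.
have hr : `|f s y r' - f s y r - 0 * (r' - r)| <= C * `|r' - r|.
  apply: (@linear_approximation (fun r => f s y r)) => [z|z Hz]; first exact: dr.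
  have := H2 s y z Ks s2 ltac:(by rewrite subrr normr0)
    ltac:(by move: r2; rewrite !ltr_norml; lra).
  have := ler_distD B (partial_r f s y z) 0; rewrite /C !subr0.
  have := normr_ge0 A; rewrite /partial_r; clear; lra.
have ht := H3 s Ks s3.
have cy : C * `|y' - y| <= e / 3 by nra.
have cr : C * `|r' - r| < e / 3 by nra.
rewrite mul0r subr0 in hy; rewrite mul0r subr0 in hr.
have := ler_distD (f s y r') (f s y' r') (f t y r).
have := ler_distD (f s y r) (f s y r') (f t y r).
lra.
Qed.

Lemma jointly_continuous_cvg K F (Fl : set_system R) {FFl : Filter Fl}
    (y r : R -> R) t y0 r0 :
  jointly_continuous_on K F -> K t ->
  (\forall s \near Fl, K s) -> id @ Fl --> t -> y @ Fl --> y0 -> r @ Fl --> r0 ->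
  F s (y s) (r s) @[s --> Fl] --> F t y0 r0.
Proof.
move=> jF Kt nK /cvgrPdist_lt ct /cvgrPdist_lt cy /cvgrPdist_lt cr.
apply/cvgrPdist_lt => e e0; have [l l0 H] := jF t y0 r0 Kt e e0.
near=> s; rewrite distrC; apply: H; rewrite 1?distrC.
- by near: s.
- by near: s; apply: ct.
- by near: s; apply: cy.
- by near: s; apply: cr.
Unshelve. all: by end_near. Qed.

Lemma convex_tangent h r q :
  (forall r1 r2 gamma : R, 0 <= gamma <= 1 ->
    h (gamma * r1 + (1 - gamma) * r2) <= gamma * h r1 + (1 - gamma) * h r2) ->
  derivable h r 1 -> 0 <= h q - h r - (q - r) * derive1 h r.
Proof.
move=> cvx dh; apply: (@ler_eps_scaled _ _ _ `|q - r|) => e e0.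
have : (fun k => k^-1 *: (h (k + r) - h r)) @ 0^' --> derive1 h r.
  move: dh => /cvg_ex[l].
  have E : (fun k : R => k^-1 *: (h (k *: 1 + r) - h r)) =
     (fun k => k^-1 *: (h (k + r) - h r)) by apply/funext => k; rewrite [k *: 1]mulr1.
  by rewrite /= E => hl; rewrite /derive1 (cvg_lim _ hl).
move=> /cvgrPdist_lt/(_ e e0)/nbhs_ballP[l /= l0 lB].
have n0 := normr_ge0 (q - r).
(* Small enough for the increment gam * (q - r) to fall in the ball where the difference quotient is
   within e of the derivative; the + 1 avoids a division by 0. *)
pose gam := Num.min 1 (l / 2 / (`|q - r| + 1)).
have p0 : 0 < l / 2 / (`|q - r| + 1) by rewrite divr_gt0//; lra.
have g0 : 0 < gam by rewrite lt_min ltr01.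
have g1 : gam <= 1 by rewrite ge_min lexx.
have g2 : gam <= l / 2 / (`|q - r| + 1) by rewrite ge_min lexx orbT.
have g3 : gam * (`|q - r| + 1) <= l / 2 by rewrite -ler_pdivlMr//; lra.
have := cvx q r gam ltac:(by rewrite g1 ltW).
have -> : gam * q + (1 - gam) * r = gam * (q - r) + r by ring.
have [->|qr] := eqVneq q r.
  by move=> _; rewrite !subrr mul0r normr0 mulr0 subr0 addr0.
have d0 : gam * (q - r) != 0 by rewrite mulf_neq0 ?subr_eq0// gt_eqF.
have := lB (gam * (q - r)); rewrite /ball /= sub0r normrN normrM (gtr0_norm g0).
move=> /(_ ltac:(by nra) d0); set D := derive1 h r; set W := h (_ + r).
rewrite -[_ *: _]/(_ * _) => h1 h2.
have : `|D * (gam * (q - r)) - (W - h r)| < e * (gam * `|q - r|).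
  have -> : D * (gam * (q - r)) - (W - h r) =
      (D - (gam * (q - r))^-1 * (W - h r)) * (gam * (q - r)).
    by rewrite [RHS]mulrBl [X in _ = _ - X]mulrAC mulVf// mul1r.
  by rewrite normrM normrM (gtr0_norm g0) ltr_pM2r// mulr_gt0// normr_gt0 subr_eq0.
rewrite ltr_norml => /andP[h3 h4].
rewrite -(@ler_pM2l _ gam)//; nra.
Qed.

(** Limits of x^sigma require the jump operator itself to converge: for s between t and a later
    point s' of I, sigma(s) <= s'. *)
Lemma near_right_filter I a b t : compact_time_scale I a b -> right_dense I t ->
  [/\ \forall s \near within I t^'+, kappa I s, id @ within I t^'+ --> t &
      forward_jump I @ within I t^'+ --> t].
Proof.
move=> ts rd; have tb := right_dense_lt ts rd; split.
- apply/near_right_withinP; exists (b - t); first by rewrite subr_gt0.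
  by move=> s Is ss; apply: (kappa_lt ts) => //; lra.
- apply/cvgrPdist_lt => e e0; apply/near_right_withinP; exists e => // s Is ss.
  by rewrite ltr0_norm; lra.
- apply/cvgrPdist_lt => e e0; apply/near_right_withinP.
  have [s' Is' ss'] := right_dense_approx ts rd e0.
  exists (s' - t); first by lra.
  move=> s Is ss; have [Ij sj jl] := forward_jumpP ts Is.
  have := jl s' Is' ltac:(by lra).
  by rewrite ler0_norm; lra.
Qed.

(** For s < t the jump does not pass t, so sigma(s) tends to t even when t is right-scattered. Left
    limits therefore involve x(t), not x(sigma(t)). *)
Lemma near_left_filter I a b t : compact_time_scale I a b -> left_dense I t ->
  [/\ \forall s \near within I t^'-, kappa I s, id @ within I t^'- --> t &
      forward_jump I @ within I t^'- --> t].
Proof.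
move=> ts ld; have [It _ _] := ld; have [_ _ _ /(_ _ It)/andP[_ tb]] := ts; split.
- apply/near_left_withinP; exists 1 => // s Is ss.
  by apply: (kappa_lt ts) => //; lra.
- apply/cvgrPdist_lt => e e0; apply/near_left_withinP; exists e => // s Is ss.
  by rewrite gtr0_norm; lra.
- apply/cvgrPdist_lt => e e0; apply/near_left_withinP; exists e => // s Is ss.
  have [Ij sj jl] := forward_jumpP ts Is; have jt := jl t It ltac:(by lra).
  by rewrite ger0_norm; lra.
Qed.

Lemma near_filter I a b t : compact_time_scale I a b -> right_dense I t ->
  [/\ \forall s \near within I (nbhs t), kappa I s, id @ within I (nbhs t) --> t &
      forward_jump I @ within I (nbhs t) --> t].
Proof.
move=> ts rd; have tb := right_dense_lt ts rd; have [It _ jE] := rd; split.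
- apply/near_withinP; exists (b - t); first by rewrite subr_gt0.
  by move=> s Is; rewrite ltr_norml => ss; apply: (kappa_lt ts) => //; lra.
- apply/cvgrPdist_lt => e e0; apply/near_withinP; exists e => // s Is.
  by rewrite distrC.
- apply/cvgrPdist_lt => e e0; apply/near_withinP.
  have [s' Is' ss'] := right_dense_approx ts rd e0.
  exists (s' - t); first by lra.
  move=> s Is; rewrite !ltr_norml => ss; have [Ij sj jl] := forward_jumpP ts Is.
  have := jl s' Is' ltac:(by lra); lra.
Qed.

Lemma forward_jump_cvg I a b x (Fl : set_system R) {FFl : Filter Fl} t :
  compact_time_scale I a b -> {within I, continuous x} -> I t ->
  (\forall s \near Fl, kappa I s) -> forward_jump I @ Fl --> t ->
  x (forward_jump I s) @[s --> Fl] --> x t.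
Proof.
move=> ts /within_continuousP cx It nK /cvgrPdist_lt cj.
apply/cvgrPdist_lt => e e0; have [l l0 H] := cx t It e e0.
near=> s; rewrite distrC; apply: H; rewrite 1?distrC.
- have Ks : kappa I s by near: s.
  by have [Ij _ _] := forward_jumpP ts Ks.1.
- by near: s; apply: cj.
Unshelve. all: by end_near. Qed.

Lemma integrand_cvg I a b F x (Fl : set_system R) {FFl : Filter Fl} t l :
  compact_time_scale I a b -> jointly_continuous_on (kappa I) F ->
  {within I, continuous x} -> kappa I t ->
  [/\ \forall s \near Fl, kappa I s, id @ Fl --> t & forward_jump I @ Fl --> t] ->
  delta_derivative I x @ Fl --> l ->
  F s (x (forward_jump I s)) (delta_derivative I x s) @[s --> Fl] --> F t (x t) l.
Proof.
move=> ts jF cx Kt [nK ct cj] cl; apply: (jointly_continuous_cvg jF) => //.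
by apply: (forward_jump_cvg ts) => //; exact: Kt.1.
Qed.

Lemma excess_cvg I a b f x q (Fl : set_system R) {FFl : Filter Fl} t l :
  compact_time_scale I a b -> jointly_continuous_on (kappa I) f ->
  jointly_continuous_on (kappa I) (partial_r f) ->
  {within I, continuous x} -> kappa I t ->
  [/\ \forall s \near Fl, kappa I s, id @ Fl --> t & forward_jump I @ Fl --> t] ->
  delta_derivative I x @ Fl --> l ->
  excess f s (x (forward_jump I s)) (delta_derivative I x s) q @[s --> Fl]
    --> excess f t (x t) l q.
Proof.
move=> ts jf jr cx Kt H cl; have [nK ct cj] := H.
apply: cvgB; first apply: cvgB.
- apply: (jointly_continuous_cvg jf) => //; last exact: cvg_cst.
  by apply: (forward_jump_cvg ts) => //; exact: Kt.1.
- exact: (integrand_cvg ts jf).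
- apply: cvgM; last exact: (integrand_cvg ts jr).
  by apply: cvgB => //; exact: cvg_cst.
Qed.

(** Existence excludes the default value in [delta_integral]. The integrand inherits one-sided
    limits from x^Delta and is continuous at a right-dense point wherever x^Delta is. *)
Lemma integrand_antiderivative I a b f x : compact_time_scale I a b -> a < b ->
  jointly_continuous_on (kappa I) f -> C1_prd I x ->
  exists G, antiderivative I
    (fun t => f t (x (forward_jump I t)) (delta_derivative I x t)) G.
Proof.
move=> ts ab jf C1; have [cx _ [[xr xl] xfin]] := C1.
set g := fun t => _.
have grd t l : right_dense I t -> delta_derivative I x @ within I t^'+ --> l ->
    g @ within I t^'+ --> f t (x t) l.
  move=> rd; apply: (integrand_cvg ts) => //; last exact: (near_right_filter ts).
  by apply: (kappa_lt ts) (right_dense_lt ts rd); case: rd.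
have gld t l : left_dense I t -> delta_derivative I x @ within I t^'- --> l ->
    g @ within I t^'- --> f t (x t) l.
  move=> ld; apply: (integrand_cvg ts) => //; last exact: (near_left_filter ts).
  exact: kappa_left_dense.
apply: (antiderivative_exists ts ab).
  split; first split.
  - by move=> t rd; apply/cvg_ex; eexists; apply: grd rd (xr _ rd).
  - by move=> t ld; apply/cvg_ex; eexists; apply: gld ld (xl _ ld).
  - apply: sub_finite_set xfin => t [rd ng]; split=> // cxt; apply: ng.
    have [It _ jE] := rd; rewrite {2}/g jE.
    apply: (integrand_cvg ts) => //; last exact: (near_filter ts).
    by apply: (kappa_lt ts) (right_dense_lt ts rd).
(* At a left-dense maximum the integrand is evaluated with the derivative of x at b, which is the
   left limit. *)
move=> ld; have xlb := xl _ ld.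
have D := C1_prd_left_derivative_max ts C1 xlb.
rewrite {2}/g (forward_jump_max ts) (delta_derivativeE ts ab _ D).
  exact: gld.
exact: kappa_left_dense.
Qed.

End Integrands.

(** * Piecewise linear perturbations *)

Section NeedleVariation.
Context {R : realType}.
Implicit Types (I : set R) (f : R -> R -> R -> R) (x y psi : R -> R)
  (a b c h k l s t u v e p q : R) (L : seq R).

Lemma seq_isolated L s :
  exists2 e, 0 < e & forall p, p \in L -> p != s -> e <= `|p - s|.
Proof.
elim: L => [|p L [e e0 He]]; first by exists 1.
have [ps|ps] := eqVneq p s.
  by exists e => // p'; rewrite inE => /orP[/eqP ->|]; [rewrite ps eqxx|exact: He].
exists (Num.min e `|p - s|); first by rewrite lt_min e0 normr_gt0 subr_eq0.
move=> p'; rewrite inE ge_min => /orP[/eqP -> _|pL p's]; first by rewrite lexx orbT.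
by rewrite He.
Qed.

Lemma near_addr_cvg (Fl : set_system R) {FFl : Filter Fl} (x y : R -> R) k l :
  (\forall s \near Fl, y s = x s + k) -> x @ Fl --> l -> y @ Fl --> l + k.
Proof.
move=> xy /cvgrPdist_lt xl; apply/cvgrPdist_lt => e e0.
near=> s; have -> : y s = x s + k by near: s.
by rewrite opprD addrACA subrr addr0; near: s; apply: xl.
Unshelve. all: by end_near. Qed.

(** The last hypothesis makes psi constant between consecutive points of L. Close to any point, and
    on one side of it, the derivative is thus only shifted by a constant, so its one-sided limits
    persist. *)
Lemma C1_prd_perturb I a b x y psi L : compact_time_scale I a b -> a < b ->
  C1_prd I x -> {within I, continuous y} ->
  (forall p, p \in L -> right_dense I p) ->
  (forall s, I s -> s \notin L -> is_delta_derivative I y s (psi s)) ->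
  (forall u v, u <= v -> (forall p, p \in L -> p < u \/ v < p) -> psi u = psi v) ->
  C1_prd I (fun s => x s + y s) /\
  exists L', forall s, I s -> s < b ->
    (right_dense I s /\ s \in L') \/
    delta_derivative I (fun s => x s + y s) s = delta_derivative I x s + psi s.
Proof.
move=> ts ab C1 cy Lrd Dy psiE; have [cx fx [[xr xl] xfin]] := C1.
have /finite_seqP[Lx LxE] := fx.
(* The point b is listed because it may lie outside [kappa I], where [delta_derivative] is an
   arbitrary choice. *)
set z := fun s => _; set L' := b :: L ++ Lx.
have Dz s : kappa I s -> s \notin L -> s \notin Lx ->
    is_delta_derivative I z s (delta_derivative I x s + psi s).
  move=> Ks sL sLx; apply: delta_derivativeD; last by apply: Dy => //; exact: Ks.1.
  apply: delta_derivativeP; apply: contrapT => nd.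
  have : [set t | kappa I t /\ ~ delta_differentiable I x t] s by [].
  by rewrite LxE /= (negPf sLx).
have DzE s : I s -> s \notin L' ->
    delta_derivative I z s = delta_derivative I x s + psi s.
  move=> Is; rewrite inE mem_cat !negb_or => /and3P[sb sL sLx].
  have Ks : kappa I s.
    have [_ _ _ /(_ _ Is)/andP[_ sb']] := ts.
    by apply: (kappa_lt ts) => //; rewrite lt_neqAle sb.
  by apply: (delta_derivativeE ts ab Ks); apply: Dz.
have avoid s u v e : (forall p, p \in L' -> p != s -> e <= `|p - s|) -> u <= v ->
    (s < u \/ v < s) -> s - e < u -> v < s + e -> psi u = psi v.
  move=> He uv suv se es; apply: psiE => // p pL.
  have [->|ps] := eqVneq p s; first by case: suv; [left|right].
  have := He p ltac:(by rewrite inE mem_cat pL orbT) ps.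
  by have [ps'|sp] := leP p s; [rewrite ler0_norm; lra|rewrite gtr0_norm; lra].
have far s s' e : (forall p, p \in L' -> p != s -> e <= `|p - s|) ->
    s' != s -> `|s' - s| < e -> s' \notin L'.
  by move=> He s's s'e; apply/negP => /He/(_ s's); rewrite leNgt s'e.
split.
  split.
  - move/within_continuousP : cx => cx; move/within_continuousP : cy => cy.
    apply/within_continuousP => t It e e0.
    have [l1 l10 H1] := cx t It (e / 2) ltac:(by lra).
    have [l2 l20 H2] := cy t It (e / 2) ltac:(by lra).
    exists (Num.min l1 l2); first by rewrite lt_min l10.
    move=> s Is; rewrite lt_min => /andP[s1 s2].
    have := H1 s Is s1; have := H2 s Is s2.
    have := ler_normD (x s - x t) (y s - y t); rewrite addrACA -opprD -/(z s) -/(z t).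
    lra.
  - apply: (@sub_finite_set _ _ [set` L ++ Lx]); last exact: finite_seq.
    move=> s [Ks nd] /=; apply: contrapT => /negP.
    rewrite mem_cat negb_or => /andP[sL sLx].
    by apply: nd; eexists; apply: Dz.
  - split; first split.
    + move=> s rd; have [e e0 He] := seq_isolated L' s.
      (* The point s + e / 2 samples the constant value of psi on ]s, s + e[, which is free of
         points of L. *)
      apply/cvg_ex; exists (lim (delta_derivative I x @ within I s^'+) + psi (s + e / 2)).
      apply: near_addr_cvg (xr _ rd); apply/near_right_withinP.
      exists e => // s' Is' ss'; rewrite /= DzE//; last first.
        by apply: (far s s' e He); [rewrite gt_eqF//; lra|rewrite gtr0_norm; lra].
      congr (_ + _); case: (leP s' (s + e / 2)) => ?; [|symmetry];
        by apply: (avoid s _ _ e He); try lra; left; lra.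
    + move=> s ld; have [e e0 He] := seq_isolated L' s.
      apply/cvg_ex; exists (lim (delta_derivative I x @ within I s^'-) + psi (s - e / 2)).
      apply: near_addr_cvg (xl _ ld); apply/near_left_withinP.
      exists e => // s' Is' ss'; rewrite /= DzE//; last first.
        by apply: (far s s' e He); [rewrite lt_eqF//; lra|rewrite ltr0_norm; lra].
      congr (_ + _); case: (leP s' (s - e / 2)) => ?; [|symmetry];
        by apply: (avoid s _ _ e He); try lra; right; lra.
    + apply: (@sub_finite_set _ _ ([set` L'] `|`
        [set t | right_dense I t /\
           ~ delta_derivative I x @ within I (nbhs t) --> delta_derivative I x t])).
        move=> s [rd nz]; have [sL'|sL'] := boolP (s \in L'); first by left.
        right; split=> // cxs; apply: nz.
        have [e e0 He] := seq_isolated L' s; have [Is _ _] := rd.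
        rewrite DzE//.
        apply: near_addr_cvg cxs; apply/near_withinP.
        exists e => // s' Is' ss'; rewrite /=.
        have [->|s's] := eqVneq s' s; first by rewrite DzE.
        rewrite DzE//; last exact: (far s s' e He).
        congr (_ + _).
        have noL u v : u <= v -> `|u - s| < e -> `|v - s| < e ->
            forall p, p \in L -> p < u \/ v < p.
          move=> uv us vs p pL.
          have pL' : p \in L' by rewrite inE mem_cat pL orbT.
          have ps : p != s by apply: contraNneq sL' => <-.
          have := He p pL' ps; move: us vs; rewrite !ltr_norml.
          have [ps'|sp] := leP p s; [rewrite ler0_norm; lra|rewrite gtr0_norm; lra].
        have ss0 : `|s - s| < e by rewrite subrr normr0.
        by case: (leP s' s) => ?; [|symmetry]; apply: psiE; try lra;
          apply: noL => //; lra.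
      by rewrite finite_setU; split => //; exact: finite_seq.
exists L' => s Is sb; have [sL'|sL'] := boolP (s \in L'); last by right; apply: DzE.
move: (sL'); rewrite inE mem_cat (lt_eqF sb) /= => /orP[sL|sLx].
  by left; split=> //; apply: Lrd.
left; split=> //; apply: (C1_prd_nondifferentiable ts C1) => //.
by have : [set` Lx] s by []; rewrite -LxE => -[].
Qed.

(** The peak is h, at t + h. The right foot t + l is not a parameter; it is fixed by k (l - h) = h.
    Writing it with max and min makes continuity immediate. *)
Definition tent t h k s : R := Num.max 0 (Num.min (s - t) (h + k * (t + h - s))).

(** At the corners t, t + h and t + l the value 0 is a convention; they are treated as exceptional
    points. *)
Definition tent_slope t h k l s : R :=
  if t < s < t + h then 1 else if t + h < s < t + l then - k else 0.

Lemma tent_continuous t h k : continuous (tent t h k).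
Proof.
have c0 : continuous (fun _ : R => 0 : R) by exact: cst_continuous.
have c1 : continuous (fun s => s - t).
  by move=> s; apply: cvgB; [exact: cvg_id|exact: cvg_cst].
have c2 : continuous (fun s => h + k * (t + h - s)).
  move=> s; apply: cvgD; first exact: cvg_cst.
  apply: cvgM; first exact: cvg_cst.
  by apply: cvgB; [exact: cvg_cst|exact: cvg_id].
exact: (max_fun_continuous c0 (min_fun_continuous c1 c2)).
Qed.

Section Tent.
Context (I : set R) (a b t h k l : R).
Context (ts : compact_time_scale I a b)
  (hkl : [/\ 0 < h, 0 < k, h < l & k * (l - h) = h])
  (tlI : forall s, t <= s <= t + l -> I s).

Let phi := tent t h k.

Lemma tent_left s : s <= t -> phi s = 0.
Proof.
have [h0 k0 hl klh] := hkl.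
by rewrite /phi /tent => st; apply/max_idPl; rewrite ge_min; apply/orP; left; lra.
Qed.

Lemma tent_right s : t + l <= s -> phi s = 0.
Proof.
have [h0 k0 hl klh] := hkl.
rewrite /phi /tent => st; apply/max_idPl; rewrite ge_min; apply/orP; right.
have := ler_wpM2l (ltW k0) st; lra.
Qed.

Lemma tent_up s : t <= s <= t + h -> phi s = s - t.
Proof.
have [h0 k0 hl klh] := hkl.
rewrite /phi /tent => /andP[s1 s2].
have -> : Num.min (s - t) (h + k * (t + h - s)) = s - t by apply/min_idPl; nra.
by apply/max_idPr; lra.
Qed.

Lemma tent_down s : t + h <= s <= t + l -> phi s = h + k * (t + h - s).
Proof.
have [h0 k0 hl klh] := hkl.
rewrite /phi /tent => /andP[s1 s2].
have -> : Num.min (s - t) (h + k * (t + h - s)) = h + k * (t + h - s).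
  by apply/min_idPr; nra.
by apply/max_idPr; nra.
Qed.

Lemma tent_bound s : 0 <= phi s <= h.
Proof.
have [h0 k0 hl klh] := hkl.
have [st|st] := leP s t; first by rewrite tent_left// lexx ltW.
have [st2|st2] := leP (t + l) s; first by rewrite tent_right// lexx ltW.
have [sh|sh] := leP s (t + h); first by rewrite tent_up; lra.
rewrite tent_down; last lra.
by apply/andP; split; nra.
Qed.

Lemma tent_slope_constant u v : u <= v ->
  (forall p, p \in [:: t; t + h; t + l] -> p < u \/ v < p) ->
  tent_slope t h k l u = tent_slope t h k l v.
Proof.
have [h0 k0 hl klh] := hkl.
move=> uv H; have H1 := H t ltac:(by rewrite !inE eqxx).
have H2 := H (t + h) ltac:(by rewrite !inE eqxx orbT).
have H3 := H (t + l) ltac:(by rewrite !inE eqxx !orbT).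
rewrite /tent_slope.
have -> : (t < u < t + h) = (t < v < t + h) by apply/idP/idP; lra.
by have -> : (t + h < u < t + l) = (t + h < v < t + l) by apply/idP/idP; lra.
Qed.

Lemma tent_delta_derivative s : I s -> s \notin [:: t; t + h; t + l] ->
  is_delta_derivative I phi s (tent_slope t h k l s).
Proof.
have [h0 k0 hl klh] := hkl.
move=> Is; rewrite !inE !negb_or => /and3P[st sh sl].
have [Ij sj jl] := forward_jumpP ts Is; set j := forward_jump I s in Ij sj jl *.
have It : I t by apply: tlI; lra.
(* Off the corners one affine formula describes phi near s and at sigma(s), so the derivative
   estimate holds with error 0. For s < t this uses sigma(s) <= t, and inside the real interval
   sigma(s) = s. *)
suff [dl dl0 H] : exists2 dl : R, 0 < dl & forall s', I s' -> s - dl < s' < s + dl ->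
    phi j - phi s' = tent_slope t h k l s * (j - s').
  move=> e e0; exists dl => // s' Is' ss'.
  by rewrite H// subrr normr0 mulr_ge0// ltW.
have [{}st|ts'] := ltP s t.
  exists (t - s); first lra.
  move=> s' Is' ss'; have := jl t It st => jt.
  rewrite !tent_left; [|lra|by []].
  by rewrite /tent_slope !ifF ?mul0r ?subrr//; lra.
have {}st : t < s by rewrite lt_neqAle eq_sym st.
have [ls|{}sl] := leP (t + l) s.
  have {}sl : t + l < s by rewrite lt_neqAle eq_sym sl.
  exists (s - (t + l)); first lra.
  move=> s' Is' ss'; rewrite !tent_right; [|lra|lra].
  by rewrite /tent_slope !ifF ?mul0r ?subrr//; lra.
have jE : j = s.
  apply: (forward_jump_inside (e := t + l - s) ts Is); last lra.
  by move=> e' e'0 e'l; apply: tlI; lra.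
have [{}sh|hs] := ltP s (t + h).
  exists (Num.min (s - t) (t + h - s)); first by rewrite lt_min; apply/andP; split; lra.
  have m1 : Num.min (s - t) (t + h - s) <= s - t by rewrite ge_min lexx.
  have m2 : Num.min (s - t) (t + h - s) <= t + h - s by rewrite ge_min lexx orbT.
  move=> s' Is' ss'; rewrite jE !tent_up; [|lra|lra].
  by rewrite /tent_slope ifT ?mul1r; lra.
have {}sh : t + h < s by rewrite lt_neqAle eq_sym sh.
exists (Num.min (s - (t + h)) (t + l - s)).
  by rewrite lt_min; apply/andP; split; lra.
have m1 : Num.min (s - (t + h)) (t + l - s) <= s - (t + h) by rewrite ge_min lexx.
have m2 : Num.min (s - (t + h)) (t + l - s) <= t + l - s by rewrite ge_min lexx orbT.
move=> s' Is' ss'; rewrite jE !tent_down; [|lra|lra].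
by rewrite /tent_slope ifF ?ifT; [ring|lra|lra].
Qed.

End Tent.
End NeedleVariation.

(** * The needle variation on a real interval *)

Section Weierstrass.
Context {R : realType}.
Implicit Types (I K : set R) (f : R -> R -> R -> R) (x : R -> R)
  (a b c d h k l s t p q e : R).

Lemma functionalE I a b f x : compact_time_scale I a b -> a < b ->
  jointly_continuous_on (kappa I) f -> C1_prd I x ->
  exists2 G, antiderivative I
    (fun t => f t (x (forward_jump I t)) (delta_derivative I x t)) G &
    functional I f a b x = G b - G a.
Proof.
move=> ts ab jf C1; have ex := integrand_antiderivative ts ab jf C1.
by eexists; last by []; exact: (xgetPex (fun=> 0) ex).
Qed.

Lemma antiderivative_sub I G1 G2 (g1 g2 : R -> R) :
  antiderivative I g1 G1 -> antiderivative I g2 G2 ->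
  {within I, continuous (fun s => G1 s - G2 s)} /\
  exists L : seq R, forall s, kappa I s ->
    (right_dense I s /\ s \in L) \/
    is_delta_derivative I (fun s => G1 s - G2 s) s (g1 s - g2 s).
Proof.
case=> /within_continuousP c1 [F1 [/finite_seqP[L1 ->] rd1 D1]].
case=> /within_continuousP c2 [F2 [/finite_seqP[L2 ->] rd2 D2]].
split.
  apply/within_continuousP => t It e e0.
  have [l1 l10 H1] := c1 t It (e / 2) ltac:(by lra).
  have [l2 l20 H2] := c2 t It (e / 2) ltac:(by lra).
  exists (Num.min l1 l2); first by rewrite lt_min l10.
  move=> s Is; rewrite lt_min => /andP[s1 s2].
  have := H1 s Is s1; have := H2 s Is s2.
  have := ler_normB (G1 s - G1 t) (G2 s - G2 t).
  rewrite (_ : G1 s - G1 t - (G2 s - G2 t) = G1 s - G2 s - (G1 t - G2 t)); last by ring.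
  lra.
exists (L1 ++ L2) => s Ks; rewrite mem_cat.
have [sL1|sL1] := boolP (s \in L1); first by left; split=> //; apply: rd1.
have [sL2|sL2] := boolP (s \in L2); first by left; split=> //; apply: rd2.
right; apply: delta_derivativeD; first by apply: D1 => //; exact/negP.
by apply: delta_derivativeN; apply: D2 => //; exact/negP.
Qed.

(** The state needs only a crude Lipschitz constant C, its change being at most |c| h on a stretch
    shorter than l; the slope needs the first-order term, which survives division by h. *)
Lemma integrand_increment_le K f t p (x0 C e eta s y y' r r' : R) :
  (forall t y r : R, K t -> derivable (fun y => f t y r) y 1) ->
  (forall t y r : R, K t -> derivable (fun r => f t y r) r 1) ->
  (forall s (y z : R), K s -> `|s - t| < eta -> `|y - x0| < eta -> `|z - p| < eta ->
     `|partial_x f s y z| <= C) ->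
  (forall s (y z : R), K s -> `|s - t| < eta -> `|y - x0| < eta -> `|z - p| < eta ->
     `|partial_r f s y z - partial_r f t x0 p| <= e) ->
  K s -> `|s - t| < eta -> `|y - x0| < eta -> `|y' - x0| < eta ->
  `|r - p| < eta -> `|r' - p| < eta ->
  f s y' r' - f s y r <=
    C * `|y' - y| + partial_r f t x0 p * (r' - r) + e * `|r' - r|.
Proof.
move=> dx dr Hx Hr Ks st yx yx' rp rp'.
have h1 : `|f s y' r' - f s y r' - 0 * (y' - y)| <= C * `|y' - y|.
  apply: (@linear_approximation _ (fun y => f s y r')) => [z|z Hz]; first exact: dx.
  rewrite subr0; apply: Hx => //; move: yx yx'; rewrite !ltr_norml; lra.
have h2 : `|f s y r' - f s y r - partial_r f t x0 p * (r' - r)| <= e * `|r' - r|.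
  apply: (@linear_approximation _ (fun r => f s y r)) => [z|z Hz]; first exact: dr.
  apply: Hr => //; move: rp rp'; rewrite !ltr_norml; lra.
move: h1 h2; rewrite !ler_norml; lra.
Qed.

Lemma tent_variation I a b (alpha beta dlt : R) f x t h k l l0 c (M1 M2 : R) :
  compact_time_scale I a b -> a < b -> jointly_continuous_on (kappa I) f ->
  C1_prd I x -> x a = alpha -> x b = beta ->
  (forall x', admissible I a b alpha beta x' -> strong_norm I (x' \- x) < dlt ->
     functional I f a b x <= functional I f a b x') ->
  I t -> [/\ 0 < h, 0 < k, h < l & k * (l - h) = h] -> l < l0 ->
  (forall s, t <= s <= t + l0 -> I s) -> `|c| * h < dlt ->
  (forall s, t < s < t + h ->
     f s (x s + c * tent t h k s) (delta_derivative I x s + c)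
       - f s (x s) (delta_derivative I x s) <= M1) ->
  (forall s, t + h < s < t + l ->
     f s (x s + c * tent t h k s) (delta_derivative I x s - c * k)
       - f s (x s) (delta_derivative I x s) <= M2) ->
  0 <= M1 * h + M2 * (l - h).
Proof.
move=> ts ab jf C1 xa xb xmin It hkl ll0 tlI chd HM1 HM2; have [h0 k0 hl klh] := hkl.
have [cI Ia Ib Iab] := ts; have [cx _ _] := C1.
have c0 := normr_ge0 c; have /andP[at' _] := Iab _ It.
have tb0 : t + l0 <= b by have /tlI/Iab/andP[] : t <= t + l0 <= t + l0 by lra.
have tlI' s : t <= s <= t + l -> I s by move=> Hs; apply: tlI; lra.
pose L := [:: t; t + h; t + l].
pose phi s := c * tent t h k s; pose psi s := c * tent_slope t h k l s.
have interior s : t <= s < t + l0 -> forward_jump I s = s.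
  move=> Hs; apply: (forward_jump_inside (e := t + l0 - s) ts); last lra.
    by apply: tlI; lra.
  by move=> e' e'0 e'l; apply: tlI; lra.
have rd s : t <= s < t + l0 -> right_dense I s.
  move=> Hs; split; [by apply: tlI; lra| |exact: interior].
  by rewrite (sup_time_scale ts); lra.
(* The strict inequality l < l0 makes even the last corner t + l right-dense, hence admissible as an
   exceptional point. *)
have Lrd s : s \in L -> right_dense I s.
  move=> sL; apply: rd; move: sL; rewrite !inE.
  by case/or3P => /eqP ->; lra.
have cphi : {within I, continuous phi}.
  apply: continuous_subspaceT => s; apply: cvgM; first exact: cvg_cst.
  exact: tent_continuous.
have Dphi s : I s -> s \notin L -> is_delta_derivative I phi s (psi s).
  move=> Is sL; apply: delta_derivativeZ.
  exact: (tent_delta_derivative ts hkl tlI').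
have psi_const u v : u <= v -> (forall p, p \in L -> p < u \/ v < p) -> psi u = psi v.
  by move=> uv H; rewrite /psi (tent_slope_constant hkl uv H).
have [C1' [L' DL']] := C1_prd_perturb ts ab C1 cphi Lrd Dphi psi_const.
set x' := fun s => x s + phi s in C1' DL'.
have phib s : `|phi s| <= `|c| * h.
  have /andP[t0 th] := tent_bound t hkl s.
  by rewrite /phi normrM ler_wpM2l// ger0_norm.
have phi_left s : s <= t -> phi s = 0.
  by move=> st; rewrite /phi (tent_left hkl)// mulr0.
have phi_right s : t + l <= s -> phi s = 0.
  by move=> st; rewrite /phi (tent_right hkl)// mulr0.
have adm : admissible I a b alpha beta x'.
  split=> //; rewrite /x'; first by rewrite phi_left ?addr0.
  by rewrite phi_right ?addr0//; lra.
have nrm : strong_norm I (x' \- x) < dlt.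
  apply: le_lt_trans chd; apply: ge_sup.
    by exists `|(x' \- x) (forward_jump I t)|, t => //; apply: (kappa_lt ts) => //; lra.
  by move=> _ [s Ks <-] /=; rewrite /x' addrAC subrr add0r; exact: phib.
have := xmin x' adm nrm.
have [G aG ->] := functionalE ts ab jf C1.
have [G' aG' ->] := functionalE ts ab jf C1'.
have [cD [LD DD]] := antiderivative_sub aG' aG.
set D := fun s => G' s - G s in cD DD.
move=> Gle; have {Gle}Dab : 0 <= D b - D a by rewrite /D; lra.
pose L0 := L ++ LD ++ L'.
pose diff s := f s (x (forward_jump I s) + phi (forward_jump I s))
   (delta_derivative I x s + psi s) - f s (x (forward_jump I s)) (delta_derivative I x s).
have key s : I s -> s < b -> (right_dense I s /\ s \in L0) \/
    is_delta_derivative I D s (diff s).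
  move=> Is sb; rewrite !mem_cat.
  case: (DL' s Is sb) => [[rds sL]|DE]; first by left; split=> //; rewrite sL !orbT.
  case: (DD s (kappa_lt ts Is sb)) => [[rds sL]|].
    by left; split=> //; rewrite sL !orbT.
  by rewrite DE => HD; right.
have mv d1 d2 M : I d1 -> I d2 -> d1 <= d2 ->
    (forall s, I s -> d1 <= s < d2 -> s \in L \/ diff s <= M) ->
    D d2 - D d1 <= M * (d2 - d1).
  move=> I1 I2 d12 HM; apply: (mean_value_le ts cD I1 I2 d12 (L := L0)) => s Is Hs.
  case: (HM s Is Hs) => [sL|sM]; first by left; split; [exact: Lrd|rewrite mem_cat sL].
  have /andP[_ d2b] := Iab _ I2.
  by case: (key s Is ltac:(by lra)) => [|Ds]; [left|right; exists (diff s)].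
(* Before t the jump does not pass t, so the perturbation vanishes at sigma(s) too and both
   integrands agree. *)
have left0 : D t - D a <= 0 * (t - a).
  apply: mv => // s Is /andP[sa st]; right; rewrite /diff.
  have [_ _ jl] := forward_jumpP ts Is.
  rewrite phi_left ?jl// /psi /tent_slope !ifF; [|lra|lra].
  by rewrite mulr0 !addr0 subrr.
have Il : I (t + l) by apply: tlI; lra.
have Ih : I (t + h) by apply: tlI; lra.
have right0 : D b - D (t + l) <= 0 * (b - (t + l)).
  apply: mv => //; first lra.
  move=> s Is /andP[sl sb]; right; rewrite /diff.
  have [_ sj _] := forward_jumpP ts Is.
  rewrite phi_right ?(le_trans sl)// /psi /tent_slope !ifF; [|lra|lra].
  by rewrite mulr0 !addr0 subrr.
have up : D (t + h) - D t <= M1 * (t + h - t).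
  apply: mv => //; first lra.
  move=> s Is /andP[ts' sh]; have [->|st] := eqVneq s t; first by left; rewrite !inE eqxx.
  have {}ts' : t < s by rewrite lt_neqAle eq_sym st.
  right; rewrite /diff interior; last lra.
  by rewrite /psi /tent_slope ifT ?ts'// mulr1; apply: HM1; rewrite ts'.
have down : D (t + l) - D (t + h) <= M2 * (t + l - (t + h)).
  apply: mv => //; first lra.
  move=> s Is /andP[hs sl]; have [->|sh] := eqVneq s (t + h).
    by left; rewrite !inE eqxx orbT.
  have {}hs : t + h < s by rewrite lt_neqAle eq_sym sh.
  right; rewrite /diff interior; last lra.
  rewrite /psi /tent_slope ifF ?ifT ?hs//; last lra.
  by rewrite mulrN; apply: HM2; rewrite hs.
have -> : h = t + h - t by ring.
have -> : l - (t + h - t) = t + l - (t + h) by ring.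
by lra.
Qed.

(** The order of choice is l, then k, then h: C and m limit l, and k is taken small depending on l,
    so that |c| k and, through h <= k l, also |c| h are small. Using |c| + 1 covers c = 0. *)
Lemma needle_parameters c (C e eta m dlt : R) :
  0 < C -> 0 < e -> 0 < eta -> 0 < m -> 0 < dlt ->
  exists l h k, [/\ 0 < h, 0 < k, h < l & k * (l - h) = h] /\
    [/\ l < m, `|c| * h < dlt, `|c| * h < eta, `|c| * k < eta & C * l <= e].
Proof.
move=> C0 e0 eta0 m0 dlt0; have c0 := normr_ge0 c.
set d := `|c| in c0 *; clearbody d.
pose l := Num.min (m / 2) (e / C).
have l0 : 0 < l by rewrite lt_min !divr_gt0.
have lm : l <= m / 2 by rewrite ge_min lexx.
have lC : C * l <= e by rewrite mulrC -ler_pdivlMr// ge_min lexx orbT.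
pose k := Num.min 1 (Num.min (eta / (d + 1)) (Num.min eta dlt / (l * (d + 1)))) / 2.
have d1 : 0 < d + 1 by lra.
have k0 : 0 < k.
  by rewrite divr_gt0// !lt_min ltr01 !divr_gt0 ?mulr_gt0// lt_min eta0.
have k1 : k * (d + 1) < eta.
  rewrite -ltr_pdivlMr// /k ltr_pdivrMr//.
  apply: (@le_lt_trans _ _ (eta / (d + 1))); first by rewrite !ge_min lexx !orbT.
  by rewrite ltr_pMr ?divr_gt0// ltr1n.
have k2 : k * (l * (d + 1)) < Num.min eta dlt.
  have m'0 : 0 < Num.min eta dlt by rewrite lt_min eta0.
  rewrite -ltr_pdivlMr ?mulr_gt0// /k ltr_pdivrMr//.
  apply: (@le_lt_trans _ _ (Num.min eta dlt / (l * (d + 1)))).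
    by rewrite !ge_min lexx !orbT.
  by rewrite ltr_pMr ?divr_gt0 ?mulr_gt0// ltr1n.
move: k2; rewrite lt_min => /andP[k2 k3].
(* The solution of k (l - h) = h. *)
clearbody k l; pose h := k * l / (1 + k).
have hE : h * (1 + k) = k * l by rewrite /h mulfVK//; lra.
have h0 : 0 < h by rewrite divr_gt0 ?mulr_gt0//; lra.
clearbody h.
have hkl : h <= k * l by nra.
exists l, h, k; split; split=> //; first [lra|nra].
Qed.

Lemma needle_inequality I a b (alpha beta : R) f x t l0 p q :
  compact_time_scale I a b -> a < b ->
  let K := kappa I in
  (forall t y r : R, K t -> derivable (fun y => f t y r) y 1) ->
  (forall t y r : R, K t -> derivable (fun r => f t y r) r 1) ->
  jointly_continuous_on K (partial_x f) -> jointly_continuous_on K (partial_r f) ->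
  jointly_continuous_on K f ->
  strong_local_minimum I f a b alpha beta x ->
  I t -> 0 < l0 -> (forall s, t <= s <= t + l0 -> I s) ->
  delta_derivative I x @ within I t^'+ --> p ->
  0 <= excess f t (x t) p q.
Proof.
move=> ts ab K dx dr jx jr jf [[C1 xa xb] [dlt dlt0 xmin]] It l00 tlI.
move=> /cvgrPdist_lt xp; have [_ _ _ Iab] := ts.
have tb0 : t + l0 <= b by have /tlI/Iab/andP[] : t <= t + l0 <= t + l0 by lra.
have Kt : K t by apply: (kappa_lt ts) => //; lra.
have [cx _ _] := C1.
pose c := q - p; have c0 := normr_ge0 c.
(* The error is 2 e from the continuity of f on the rising part, and on the falling part |c| e from
   the variation of f_r and |c| e from C l <= e. *)
apply: (@ler_eps_scaled _ _ _ (2 + 2 * `|c|)) => e e0.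
have [l1 l10 H1] := jf t (x t) q Kt e e0.
have [l2 l20 H2] := jf t (x t) p Kt e e0.
have [l3 l30 H3] := jr t (x t) p Kt e e0.
have [l4 l40 H4] := jx t (x t) p Kt 1 ltr01.
pose C := `|partial_x f t (x t) p| + 1.
have C0 : 0 < C by rewrite ltr_wpDl.
pose eta := Num.min (Num.min l1 l2) (Num.min l3 l4).
have eta0 : 0 < eta by rewrite !lt_min l10 l20 l30 l40.
have etaP (z : R) : `|z| < eta ->
    [/\ `|z| < l1, `|z| < l2, `|z| < l3 & `|z| < l4].
  by rewrite !lt_min => /andP[/andP[-> ->] /andP[-> ->]].
clearbody eta.
have {}H1 s (y z : R) : K s -> `|s - t| < eta -> `|y - x t| < eta -> `|z - q| < eta ->
    `|f s y z - f t (x t) q| < e.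
  by move=> Ks /etaP[? _ _ _] /etaP[? _ _ _] /etaP[? _ _ _]; apply: H1.
have {}H2 s (y z : R) : K s -> `|s - t| < eta -> `|y - x t| < eta -> `|z - p| < eta ->
    `|f s y z - f t (x t) p| < e.
  by move=> Ks /etaP[_ ? _ _] /etaP[_ ? _ _] /etaP[_ ? _ _]; apply: H2.
have {}H3 s (y z : R) : K s -> `|s - t| < eta -> `|y - x t| < eta -> `|z - p| < eta ->
    `|partial_r f s y z - partial_r f t (x t) p| <= e.
  by move=> Ks /etaP[_ _ ? _] /etaP[_ _ ? _] /etaP[_ _ ? _]; apply/ltW/H3.
have {}H4 s (y z : R) : K s -> `|s - t| < eta -> `|y - x t| < eta -> `|z - p| < eta ->
    `|partial_x f s y z| <= C.
  move=> Ks /etaP[_ _ _ s4] /etaP[_ _ _ y4] /etaP[_ _ _ z4].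
  have := H4 s y z Ks s4 y4 z4.
  have := ler_distD (partial_x f t (x t) p) (partial_x f s y z) 0.
  by rewrite /C !subr0; lra.
clear etaP l1 l10 l2 l20 l3 l30 l4 l40.
(* The function x and its derivative get half of eta, which leaves the other half for the
   perturbations |c| h and |c| k. *)
have eta20 : 0 < eta / 2 by move: eta0; clear; lra.
have half_eta : eta / 2 < eta by move: eta0; clear; lra.
have /within_continuousP/(_ t It (eta / 2) eta20)[l5 l50 H5] := cx.
have /near_right_withinP[l6 l60 H6] := xp (eta / 2) eta20.
pose m := Num.min (Num.min l5 l6) (Num.min l0 eta).
have m0 : 0 < m by rewrite !lt_min l50 l60 l00 eta0.
have mP z : z < m -> [/\ z < l5, z < l6, z < l0 & z < eta].
  by rewrite !lt_min => /andP[/andP[-> ->] /andP[-> ->]].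
clearbody m.
have [l [h [k [hkl [/mP[ll5 ll6 ll0 leta] chd ch ck lC]]]]] :=
  needle_parameters c C0 e0 eta20 m0 dlt0.
have [h0 k0 hl klh] := hkl.
have inside s : t < s < t + l -> [/\ K s, `|s - t| < eta,
    `|x s - x t| < eta / 2 & `|delta_derivative I x s - p| < eta / 2].
  move=> {H1 H2 H3 H4 dx dr jx jr jf xmin klh ch chd ck lC c0 e0 C0} Hs.
  have Is : I s by apply: tlI; lra.
  have sb : s < b by lra.
  split; first exact: (kappa_lt ts).
  - by rewrite gtr0_norm; lra.
  - by apply: H5 => //; rewrite gtr0_norm; lra.
  - by rewrite distrC; apply: H6 => //; lra.
have phib s : `|c * tent t h k s| <= `|c| * h.
  have /andP[t0 th] := tent_bound t hkl s.
  by rewrite normrM ler_wpM2l// ger0_norm.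
have near_x s : `|x s - x t| < eta / 2 -> `|x s - x t| < eta /\
    `|x s + c * tent t h k s - x t| < eta.
  move: (phib s) ch eta0; clear; set d := `|c| * h.
  by rewrite ler_norml !ltr_norml; lra.
set fr := partial_r f t (x t) p in H3.
have up s : t < s < t + h ->
    f s (x s + c * tent t h k s) (delta_derivative I x s + c)
      - f s (x s) (delta_derivative I x s) <= f t (x t) q - f t (x t) p + 2 * e.
  move=> Hs; have [Ks st xs ps] := inside s ltac:(by move: Hs h0 hl; clear; lra).
  have [xs1 xs2] := near_x s xs.
  have ps1 := lt_trans ps half_eta.
  have ps2 : `|delta_derivative I x s + c - q| < eta.
    by rewrite /c (_ : _ + _ - q = delta_derivative I x s - p)//; ring.
  have := H1 _ _ _ Ks st xs2 ps2; have := H2 _ _ _ Ks st xs1 ps1.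
  clear; rewrite !ltr_norml; lra.
have down s : t + h < s < t + l ->
    f s (x s + c * tent t h k s) (delta_derivative I x s - c * k)
      - f s (x s) (delta_derivative I x s) <=
    C * (`|c| * h) - fr * (c * k) + e * (`|c| * k).
  move=> Hs; have [Ks st xs ps] := inside s ltac:(by move: Hs h0 hl; clear; lra).
  have [xs1 xs2] := near_x s xs.
  have ckE : `|c * k| = `|c| * k by rewrite normrM (gtr0_norm k0).
  have ps1 := lt_trans ps half_eta.
  have ps2 : `|delta_derivative I x s - c * k - p| < eta.
    by move: ps ck; rewrite -ckE; clear; rewrite !ltr_norml; lra.
  have := integrand_increment_le dx dr H4 H3 Ks st xs1 xs2 ps1 ps2.
  have -> : delta_derivative I x s - c * k - delta_derivative I x s = - (c * k).
    by ring.
  have -> : x s + c * tent t h k s - x s = c * tent t h k s by ring.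
  rewrite normrN ckE -/fr; have := ler_wpM2l (ltW C0) (phib s).
  clear; lra.
have := tent_variation ts ab jf C1 xa xb xmin It hkl ll0 tlI chd up down.
have -> : (f t (x t) q - f t (x t) p + 2 * e) * h +
    (C * (`|c| * h) - fr * (c * k) + e * (`|c| * k)) * (l - h) =
    (f t (x t) q - f t (x t) p + 2 * e) * h +
    C * `|c| * (l - h) * h - fr * c * (k * (l - h)) + e * `|c| * (k * (l - h)).
  by ring.
(* Substituting k (l - h) = h makes every term a multiple of h, which is then cancelled. *)
rewrite klh -mulrDl -mulrBl -mulrDl pmulr_lge0// /excess -/fr -/c.
have : `|c| * (C * (l - h)) <= `|c| * e.
  by rewrite ler_wpM2l//; move: lC h0 C0; clear; nra.
clear; lra.
Qed.

End Weierstrass.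

(** * Passage to the limit and the necessary condition *)

Section Necessity.
Context {R : realType}.
Implicit Types (I K : set R) (f : R -> R -> R -> R) (x : R -> R)
  (a b e s t u v p q : R).

(** Nonnegativity is available only frequently along the filter: right-scattered points may
    accumulate at t without filling a neighbourhood. *)
Lemma cvg_frequently_ge0 (Fl : set_system R) {FFl : Filter Fl} (E : R -> R) (l : R) :
  E @ Fl --> l ->
  (forall P : R -> Prop, (\forall s \near Fl, P s) -> exists2 s, P s & 0 <= E s) ->
  0 <= l.
Proof.
move=> /cvgrPdist_lt El H; rewrite leNgt; apply/negP => l0.
have [s] := H _ (El (- l) ltac:(by rewrite oppr_gt0)).
by rewrite ltr_norml; lra.
Qed.

(** A gap at r would begin at m, the last point of I before r: m is not right-scattered by
    hypothesis, and right-density puts points of I between m and r. *)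
Lemma interval_sub_time_scale I a b u v : compact_time_scale I a b -> I u ->
  (forall s, I s -> u <= s < v -> ~ s < forward_jump I s) -> v < b ->
  forall r, u <= r <= v -> I r.
Proof.
move=> ts Iu H vb r /andP[ur rv]; apply: contrapT => nIr.
pose S := [set s | I s /\ s <= r]; have [cI _ _ _] := ts.
have hS : has_sup S by split; [exists u|exists r => s []].
set m := sup S.
have um : u <= m by apply: sup_upper_bound.
have Im : I m.
  apply: closed_approx => // e e0.
  have [s [Is sr]] := sup_adherent e0 hS; rewrite -/m => se.
  have sm : s <= m by apply: sup_upper_bound.
  by exists s => //; rewrite ler0_norm; lra.
have : m <= r by apply: ge_sup; [exists u|move=> s []].
rewrite le_eqVlt => /orP[/eqP mE|mr]; first by apply: nIr; rewrite -mE.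
have mb : m < b by apply: (lt_le_trans mr); lra.
case: (right_denseP ts Im mb) => [rd|]; last by apply: H => //; lra.
have [s Is ms] := right_dense_approx ts rd (ltac:(by lra) : 0 < r - m).
have : s <= m by apply: sup_upper_bound => //; split=> //; lra.
lra.
Qed.

Lemma scattered_excess_ge0 I f t y r q :
  (forall t x r : R, kappa I t -> derivable (fun s : R => f t x s) r 1) ->
  (forall t x r1 r2 gamma : R, kappa I t -> 0 <= gamma <= 1 ->
    graininess I t * f t x (gamma * r1 + (1 - gamma) * r2) <=
      graininess I t * gamma * f t x r1
      + graininess I t * (1 - gamma) * f t x r2) ->
  kappa I t -> t < forward_jump I t -> 0 <= excess f t y r q.
Proof.
move=> dr cvx Kt tj; apply: (@convex_tangent _ (f t y)); last exact: dr.
move=> r1 r2 g Hg; have m0 : 0 < graininess I t by rewrite subr_gt0.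
by have := cvx t y r1 r2 g Kt Hg; rewrite -!mulrA -mulrDr ler_pM2l.
Qed.

Section LocalMinimum.
Context (I : set R) (a b alpha beta : R) (f : R -> R -> R -> R) (x : R -> R).
Context (ts : compact_time_scale I a b) (ab : a < b).
Context (dx : forall t y r : R, kappa I t -> derivable (fun y => f t y r) y 1)
  (dr : forall t y r : R, kappa I t -> derivable (fun r => f t y r) r 1)
  (jx : jointly_continuous_on (kappa I) (partial_x f))
  (jr : jointly_continuous_on (kappa I) (partial_r f))
  (jf : jointly_continuous_on (kappa I) f).
Context (cvx : forall t y r1 r2 gamma : R, kappa I t -> 0 <= gamma <= 1 ->
    graininess I t * f t y (gamma * r1 + (1 - gamma) * r2) <=
      graininess I t * gamma * f t y r1
      + graininess I t * (1 - gamma) * f t y r2).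
Context (xmin : strong_local_minimum I f a b alpha beta x).

Lemma right_limit_excess_ge0 t p q : right_dense I t ->
  delta_derivative I x @ within I t^'+ --> p -> 0 <= excess f t (x t) p q.
Proof.
move=> rd xp; have [[C1 _ _] _] := xmin; have [cx _ _] := C1.
have [It _ jE] := rd; have tb := right_dense_lt ts rd.
have Kt : kappa I t by apply: (kappa_lt ts).
have [H|H] := pselect (forall e, 0 < e ->
    exists2 s, I s & t < s < t + e /\ s < forward_jump I s).
  apply: (cvg_frequently_ge0
    (excess_cvg (q := q) ts jf jr cx Kt (near_right_filter ts rd) xp)) => P
    /near_right_withinP[e e0 PP].
  have [s Is [ss sj]] := H e e0; exists s; first exact: PP.
  apply: (scattered_excess_ge0 _ _ _ dr cvx _ sj).
  apply: (kappa_lt ts) => //; have [_ _ _ Iab] := ts.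
  by have [/Iab/andP[_ jb] _ _] := forward_jumpP ts Is; lra.
have [e e0 He] : exists2 e, 0 < e &
    forall s, I s -> t < s < t + e -> ~ s < forward_jump I s.
  apply: contrapT => N; apply: H => e e0; apply: contrapT => N'; apply: N.
  by exists e => // s Is ss sj; apply: N'; exists s.
pose l := Num.min e (b - t) / 2.
have m0 : 0 < Num.min e (b - t) by rewrite lt_min e0 subr_gt0.
have m1 : Num.min e (b - t) <= e by rewrite ge_min lexx.
have m2 : Num.min e (b - t) <= b - t by rewrite ge_min lexx orbT.
have l0 : 0 < l by rewrite /l; lra.
apply: (needle_inequality q ts ab dx dr jx jr jf xmin It l0 _ xp).
apply: (interval_sub_time_scale ts It); last by rewrite /l; lra.
move=> s Is /andP[]; rewrite le_eqVlt => /orP[/eqP <- _|ts' sl].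
  by rewrite jE ltxx.
by apply: He => //; move: sl; rewrite /l; lra.
Qed.

Lemma left_limit_excess_ge0 t p q : left_dense I t ->
  delta_derivative I x @ within I t^'- --> p -> 0 <= excess f t (x t) p q.
Proof.
move=> ld xp; have [[C1 _ _] _] := xmin; have [cx fx [[xr _] _]] := C1.
have Kt := kappa_left_dense ld; have /finite_seqP[L LE] := fx.
apply: (cvg_frequently_ge0
    (excess_cvg (q := q) ts jf jr cx Kt (near_left_filter ts ld) xp)) => P
    /near_left_withinP[e e0 PP].
(* Staying close to t avoids the finitely many points without derivative. At the chosen s < t,
   x^Delta(s) exists and, if s is right-dense, is a right limit, to which the previous case
   applies. *)
have [e' e'0 He'] := seq_isolated L t.
have [|s Is ss] := left_dense_approx ld (e := Num.min e e'); first by rewrite lt_min e0.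
have m1 : Num.min e e' <= e by rewrite ge_min lexx.
have m2 : Num.min e e' <= e' by rewrite ge_min lexx orbT.
exists s; first by apply: PP => //; lra.
have [_ _ _ /(_ _ Kt.1)/andP[_ tb]] := ts.
have sb : s < b by lra.
have Ks := kappa_lt ts Is sb.
case: (right_denseP ts Is sb) => [rd|sj]; last exact: (scattered_excess_ge0 _ _ _ dr cvx).
have [_ _ jE] := rd; rewrite jE.
have sL : s \notin L.
  apply/negP => /He'/(_ ltac:(by rewrite lt_eqF//; lra)).
  by rewrite ltr0_norm; lra.
have Ds : delta_differentiable I x s.
  apply: contrapT => nd.
  have : [set t | kappa I t /\ ~ delta_differentiable I x t] s by [].
  by rewrite LE /= (negPf sL).
rewrite (C1_prd_right_derivative ts C1 rd (xr _ rd) (delta_derivativeP Ds)).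
exact: right_limit_excess_ge0 (xr _ rd).
Qed.

End LocalMinimum.
End Necessity.

Theorem theorem3p3 (R : realType) (T : set R) (t0 t1 alpha beta : R)
    (f : R -> R -> R -> R) (xbar : R -> R) :
  time_scale T -> bounded_set T -> T t0 -> T t1 -> t0 < t1 ->
  let I := T `&` [set t | t0 <= t <= t1] in
  let K := kappa I in
  (forall t x r : R, K t -> derivable (fun y : R => f t y r) x 1) ->
  (forall t x r : R, K t -> derivable (fun s : R => f t x s) r 1) ->
  {within [set p : R * R * R | K p.1.1],
    continuous (fun p : R * R * R => partial_x f p.1.1 p.1.2 p.2)} ->
  {within [set p : R * R * R | K p.1.1],
    continuous (fun p : R * R * R => partial_r f p.1.1 p.1.2 p.2)} ->
  (forall x r : R, {within K, continuous (fun t : R => f t x r)}) ->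
  (forall x r : R, {within K, continuous (fun t : R => partial_x f t x r)}) ->
  (forall x r : R, {within K, continuous (fun t : R => partial_r f t x r)}) ->
  (forall t x r1 r2 gamma : R, K t -> 0 <= gamma <= 1 ->
    graininess I t * f t x (gamma * r1 + (1 - gamma) * r2) <=
      graininess I t * gamma * f t x r1
      + graininess I t * (1 - gamma) * f t x r2) ->
  C1_prd I xbar ->
  strong_local_minimum I f t0 t1 alpha beta xbar ->
  forall t q : R, K t ->
    (delta_differentiable I xbar t ->
      0 <= excess f t (xbar (forward_jump I t)) (delta_derivative I xbar t) q)
    /\
    (~ delta_differentiable I xbar t ->
      (left_dense I t ->
        0 <= excess f t (xbar (forward_jump I t))
               (limit_left I (delta_derivative I xbar) t) q)
      /\
      (right_dense I t ->
        0 <= excess f t (xbar (forward_jump I t))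
               (limit_right I (delta_derivative I xbar) t) q)).
Proof.
move=> [cT _] _ Tt0 Tt1 t01 I K dx dr cx cr cf _ _ cvx C1 xmin t q Kt.
have ts : compact_time_scale I t0 t1.
  split; [|by split=> //=; rewrite lexx ltW..|by move=> s []].
  apply: closedI => //; rewrite (_ : [set _ | _] = [set` `[t0, t1]]).
    exact: itv_closed.
  by apply/seteqP; split=> s /=; rewrite in_itv.
have jx := within_jointly_continuous cx; have jr := within_jointly_continuous cr.
have jf := jointly_continuous_of_partials dx dr jx jr cf.
have [_ _ [[xr xl] _]] := C1.
(* Convexity gives the inequality for every slope r, which covers the derivative and its left limit
   at once. *)
have scattered r : t < forward_jump I t -> 0 <= excess f t (xbar (forward_jump I t)) r q.
  exact: (scattered_excess_ge0 _ _ _ dr cvx).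
have right_ge0 r : right_dense I t ->
    delta_derivative I xbar @ within I t^'+ --> r ->
    0 <= excess f t (xbar (forward_jump I t)) r q.
  move=> rd xp; have [_ _ ->] := rd.
  exact: (right_limit_excess_ge0 ts t01 dx dr jx jr jf cvx xmin).
have left_ge0 r : left_dense I t ->
    delta_derivative I xbar @ within I t^'- --> r ->
    0 <= excess f t (xbar (forward_jump I t)) r q.
  move=> ld xp; have [_ tj _] := forward_jumpP ts Kt.1.
  (* The limit argument yields the state x(t), which is x(sigma(t)) only if sigma(t) = t; otherwise
     convexity applies directly. *)
  move: tj; rewrite le_eqVlt => /orP[/eqP <-|]; last exact: scattered.
  exact: (left_limit_excess_ge0 ts t01 dx dr jx jr jf cvx xmin).
split=> [Dt|_]; last first.
  by split=> [ld|rd]; [exact: left_ge0 (xl _ ld)|exact: right_ge0 (xr _ rd)].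
case: (kappa_cases ts t01 Kt) => [|rd|[tE ld]]; first exact: scattered.
  rewrite (C1_prd_right_derivative ts C1 rd (xr _ rd) (delta_derivativeP Dt)).
  exact: right_ge0 (xr _ rd).
(* At a left-dense maximum the derivative is the left limit, which reduces this case to
   [left_ge0]. *)
rewrite -tE in ld; have D := xl _ ld; rewrite tE in D *.
have Kt1 : kappa I t1 by rewrite -tE.
rewrite (delta_derivativeE ts t01 Kt1 (C1_prd_left_derivative_max ts C1 D)).
by rewrite -tE in D *; exact: left_ge0.
Qed.
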